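(* Let $n\ge 0$ be an integer and $\alpha>-1$. If $1\le p<\infty$ and $p(1+\alpha)>1$, then the operator norm of $T_\alpha$ on $L^p(\mathcal{U}^n)$ is $$\|T_\alpha\|_{p\to p}=\frac{(n+1)!\,\Gamma\left(1+\alpha-\frac1p\right)\Gamma\left(\frac1p\right)}{\Gamma^2\left(\frac{n+2+\alpha}{2}\right)}.$$
   Context: Write points of $\mathbb{C}^{n+1}$ as $z=(z',z_{n+1})$ with $z'=(z_1,\dots,z_n)\in\mathbb{C}^n$, $z_{n+1}\in\mathbb{C}$, and $z'\cdot\overline{w'}=\sum_{j=1}^n z_j\overline{w_j}$. The Siegel upper half-space is $\mathcal{U}^n=\{z\in\mathbb{C}^{n+1}:\operatorname{Im}z_{n+1}>|z'|^2\}$ (so $\mathcal{U}^0$ is the upper half-plane). $dV$ is Lebesgue measure on $\mathbb{C}^{n+1}$, and $L^p(\mathcal{U}^n)$ is taken with respect to $dV$. Put $$\boldsymbol{\rho}(z,w):=\tfrac{i}{2}(\overline{w}_{n+1}-z_{n+1})-z'\cdot\overline{w'},$$ so that $\boldsymbol{\rho}(w,w)=\operatorname{Im}w_{n+1}-|w'|^2$. For $\alpha>-1$ the operator $T_\alpha$ is defined by $$(T_\alpha f)(z):=\frac{(n+1)!}{4\pi^{n+1}}\int_{\mathcal{U}^n}\frac{\boldsymbol{\rho}(w,w)^{\alpha}}{|\boldsymbol{\rho}(z,w)|^{n+2+\alpha}}f(w)\,dV(w)$$ (initially for, say, continuous $f$ of compact support, and then on $L^p(\mathcal{U}^n)$).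 $\|\cdot\|_{p\to p}$ denotes the operator norm on $L^p(\mathcal{U}^n)$. *)

(* Defs.v *)
From HB Require Import structures.
From mathcomp Require Import all_boot all_order all_algebra.
From mathcomp Require Import ring complex.
From mathcomp Require Import all_classical all_reals all_analysis.

Set Implicit Arguments.
Unset Strict Implicit.
Unset Printing Implicit Defensive.

Import Order.TTheory GRing.Theory Num.Theory.
Import numFieldNormedType.Exports.

Local Open Scope classical_set_scope.
Local Open Scope ring_scope.

Notation normc := ComplexField.Normc.normc.

(* R[i] with the sigma-algebra pulled back from R * R along z |-> (Re z, Im z),
   i.e. with its Borel sets. *)
Definition pair_of_complex {R : realType} (z : R[i]) : R * R :=
  (complex.Re z, complex.Im z).
Definition complex_of_pair {R : realType} (x : R * R) : R[i] :=
  Complex x.1 x.2.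

Lemma pair_of_complexK (R : realType) :
  cancel (@pair_of_complex R) (@complex_of_pair R).
Proof. by case. Qed.

Lemma complex_of_pairK (R : realType) :
  cancel (@complex_of_pair R) (@pair_of_complex R).
Proof. by case. Qed.

Definition complex_display : measure_display.
Proof. by constructor. Qed.

Section complex_measurable.
Context (R : realType).

Definition complex_measurable : set (set R[i]) :=
  preimage_set_system setT (@pair_of_complex R) measurable.

Let measurable_set0 : complex_measurable set0.
Proof. by exists set0 => //; rewrite preimage_set0 setI0. Qed.

Let measurable_setC A : complex_measurable A -> complex_measurable (~` A).
Proof.
move=> [B mB <-]; exists (~` B); first exact: measurableC.
by rewrite !setTI preimage_setC.
Qed.

Let measurable_bigcupT (F : (set R[i])^nat) :
  (forall k, complex_measurable (F k)) -> complex_measurable (\bigcup_k F k).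
Proof.
move=> /(_ _)/cid2-/all_sig2[G mG GF].
exists (\bigcup_k G k); first exact: bigcup_measurable.
rewrite setTI preimage_bigcup; apply: eq_bigcupr => k _.
by rewrite -GF setTI.
Qed.

HB.instance Definition _ := isPointed.Build R[i] (0 : R[i]).
HB.instance Definition _ := @isMeasurable.Build complex_display R[i]
  complex_measurable measurable_set0 measurable_setC measurable_bigcupT.

End complex_measurable.

Lemma measurable_pair_of_complex (R : realType) :
  measurable_fun [set: R[i]] (@pair_of_complex R).
Proof. by move=> _ Y mY; exists Y. Qed.

Lemma measurable_complex_of_pair (R : realType) :
  measurable_fun [set: R * R] (@complex_of_pair R).
Proof.
move=> _ _ [Y mY <-]; rewrite !setTI -comp_preimage.
by rewrite (_ : _ \o _ = id) //; apply/funext => -[].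
Qed.

Section pushforward_iso.
Context d1 d2 (T1 : measurableType d1) (T2 : measurableType d2) (R : realType).
Variables (mu : {sigma_finite_measure set T1 -> \bar R}).
Variables (f : T1 -> T2) (g : T2 -> T1).
Hypotheses (mf : measurable_fun setT f) (mg : measurable_fun setT g).
Hypothesis fK : cancel f g.

Lemma sigma_finite_pushforward : sigma_finite setT (pushforward mu f).
Proof.
have [F FT Foo] := sigma_finiteT mu.
exists (fun k => g @^-1` F k).
  by rewrite -preimage_bigcup -FT preimage_setT.
move=> k; have [mF Fk] := Foo k; split.
  by rewrite -[X in measurable X]setTI; exact: mg.
rewrite /pushforward -comp_preimage.
by rewrite (_ : g \o f = id) //; apply/funext => x; exact: fK.
Qed.

(* The hypotheses are arguments so that the measure instances can be attached
   to this constant. *)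
Definition pushforward_iso of measurable_fun setT f & measurable_fun setT g &
  cancel f g : set T2 -> \bar R := pushforward mu f.

Local Notation nu := (pushforward_iso mf mg fK).

Let nu0 : nu set0 = 0%E.
Proof. by rewrite /pushforward_iso /pushforward preimage_set0 measure0. Qed.

Let nu_ge0 A : (0 <= nu A)%E. Proof. exact: measure_ge0. Qed.

Let nu_sigma_additive : semi_sigma_additive nu.
Proof.
exact: (@measure_semi_sigma_additive _ _ _
  (measure_function_pushforward__canonical__measure_function_Measure mu mf)).
Qed.

HB.instance Definition _ := isMeasure.Build _ _ _ nu
  nu0 nu_ge0 nu_sigma_additive.
HB.instance Definition _ := Measure_isSigmaFinite.Build _ _ _ nu
  sigma_finite_pushforward.

End pushforward_iso.

(* The canonical sigma-finite structure of \x only covers subprobabilities, so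
   the product of sigma-finite measures gets its own constant. *)
Section sfproduct.
Context d1 d2 (T1 : measurableType d1) (T2 : measurableType d2) (R : realType).
Variable mu : {sigma_finite_measure set T1 -> \bar R}.
Variable nu : {sigma_finite_measure set T2 -> \bar R}.

Definition sfproduct : set (T1 * T2)%type -> \bar R := (mu \x nu)%E.

HB.instance Definition _ := Measure.copy sfproduct (mu \x nu)%E.

Let sigma_finite_sfproduct : sigma_finite setT sfproduct.
Proof.
have /sigma_finiteP[F [TF ndF Foo]] := sigma_finiteT mu.
have /sigma_finiteP[G [TG ndG Goo]] := sigma_finiteT nu.
exists (fun k => F k `*` G k).
  rewrite -setXTT TF TG predeqE => -[x y]; split.
    move=> [/= [k _ Fkx] [l _ Gly]]; exists (maxn k l) => //; split.
    - by move: x Fkx; exact/subsetPset/ndF/leq_maxl.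
    - by move: y Gly; exact/subsetPset/ndG/leq_maxr.
  by move=> [k _ []/= ? ?]; split; exists k.
move=> k; have [? ?] := Foo k; have [? ?] := Goo k.
split; first exact: measurableX.
rewrite /sfproduct product_measure1E//.
by rewrite lte_mul_pinfty// ge0_fin_numE.
Qed.

HB.instance Definition _ :=
  Measure_isSigmaFinite.Build _ _ _ sfproduct sigma_finite_sfproduct.

End sfproduct.

Section tuple_measure.
Context d (T : measurableType d) (R : realType).
Variable mu : {sigma_finite_measure set T -> \bar R}.

Definition tuple_cons n (x : T * n.-tuple T) : n.+1.-tuple T :=
  [tuple of x.1 :: x.2].
Definition tuple_uncons n (t : n.+1.-tuple T) : T * n.-tuple T :=
  (thead t, [tuple of behead t]).

Lemma tuple_consK n : cancel (@tuple_cons n) (@tuple_uncons n).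
Proof. by case=> x t; congr pair; apply: val_inj. Qed.

Lemma measurable_tuple_cons n : measurable_fun setT (@tuple_cons n).
Proof. exact: measurable_cons. Qed.

Lemma measurable_tuple_uncons n : measurable_fun setT (@tuple_uncons n).
Proof.
apply/measurable_fun_pairP; split; first exact: measurable_tnth.
exact: measurable_behead.
Qed.

(* The n-fold product measure mu \x ... \x mu. *)
Fixpoint tuple_measure n : {sigma_finite_measure set (n.-tuple T) -> \bar R} :=
  match n with
  | 0 => @dirac _ (0.-tuple T) [tuple] R
  | m.+1 => pushforward_iso (sfproduct mu (tuple_measure m))
      (@measurable_tuple_cons m) (@measurable_tuple_uncons m) (@tuple_consK m)
  end.

End tuple_measure.

Definition Gamma (R : realType) (s : R) : R :=
  \int[@lebesgue_measure R]_(t in `]0, +oo[) (t `^ (s - 1) * expR (- t)).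

Definition lebesgueC (R : realType) : {sigma_finite_measure set R[i] -> \bar R} :=
  pushforward_iso (sfproduct (@lebesgue_measure R) (@lebesgue_measure R))
    (@measurable_complex_of_pair R) (@measurable_pair_of_complex R)
    (@complex_of_pairK R).

Section complex_integral.
Context d (T : measurableType d) (R : realType).
Variables (mu : {measure set T -> \bar R}) (D : set T).
Implicit Types f : T -> R[i].

Definition integrableC f : Prop :=
  mu.-integrable D (fun x => (complex.Re (f x))%:E) /\
  mu.-integrable D (fun x => (complex.Im (f x))%:E).

Definition integralC f : R[i] :=
  Complex (\int[mu]_(x in D) complex.Re (f x))
          (\int[mu]_(x in D) complex.Im (f x)).

Definition normLp (p : R) f : \bar R :=
  'N[mu]_p%:E [(fun x => (normc (f x))%:E) \_ D].

(* Complex-valued functions are only considered on D; elements of L^p(D) are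
   represented by Borel functions and not identified up to a.e. equality. *)
Definition Lp (p : R) : set (T -> R[i]) :=
  [set f | measurable_fun D f /\ (normLp p f < +oo)%E].

Definition opnormLp (p : R) (T : (T -> R[i]) -> (T -> R[i])) : \bar R :=
  ereal_sup [set normLp p (T f) | f in [set f | Lp p f /\ (normLp p f <= 1)%E]].

End complex_integral.

Section siegel.
Context (R : realType) (n : nat).
Local Notation C := R[i].

(* A point z = (z', z_{n+1}) of C^{n+1} is the pair of z' = z.1 in C^n and
   z_{n+1} = z.2 in C. *)
Local Notation Cn1 := (n.-tuple C * C)%type.
Implicit Types z w : Cn1.

Definition dV : {sigma_finite_measure set Cn1 -> \bar R} :=
  sfproduct (tuple_measure (lebesgueC R) n) (lebesgueC R).

Definition siegel : set Cn1 :=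
  [set z | \sum_(j < n) normc (tnth z.1 j) ^+ 2 < complex.Im z.2].

Definition rho z w : C :=
  'i%C / 2%:R * (conjc w.2 - z.2)
  - \sum_(j < n) tnth z.1 j * conjc (tnth w.1 j).

(* On the diagonal rho is real, so that Re (rho w w) below is rho w w. *)
Lemma rho_diag w :
  rho w w =
    (complex.Im w.2 - \sum_(j < n) normc (tnth w.1 j) ^+ 2)%:C%C.
Proof.
rewrite /rho rmorphB rmorph_sum /=; congr (_ - _).
  case: w.2 => a b /=; rewrite -mulrA mulrC -mulrA.
  have -> : (conjc (Complex a b) - Complex a b) * 'i%C = 2%:R * b%:C%C :> C.
    rewrite mulr_natl mulr2n; apply/eqP; rewrite eq_complex /=.
    by apply/andP; split; apply/eqP; ring.
  by rewrite mulrA mulVf ?mul1r// pnatr_eq0.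
apply: eq_bigr => j _; case: (tnth w.1 j) => a b /=.
rewrite sqr_sqrtr ?addr_ge0 ?sqr_ge0//.
by apply/eqP; rewrite eq_complex /=; apply/andP; split; apply/eqP; ring.
Qed.

Definition T_kernel (alpha : R) z w : R :=
  complex.Re (rho w w) `^ alpha / normc (rho z w) `^ (n%:R + 2 + alpha).

Definition T_op (alpha : R) (f : Cn1 -> C) : Cn1 -> C :=
  fun z => ((n.+1)`!%:R / (4 * pi ^+ n.+1))%:C%C *
    integralC dV siegel (fun w => (T_kernel alpha z w)%:C%C * f w).

End siegel.

(* Main.v *)
Require Import Defs.
From HB Require Import structures.
From mathcomp Require Import all_boot all_order all_algebra.
From mathcomp Require Import complex ring lra.
From mathcomp Require Import all_classical all_reals all_analysis.
From mathcomp Require Import measurable_realfun.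
Import Order.TTheory GRing.Theory Num.Theory.
Import numFieldNormedType.Exports.
Local Open Scope classical_set_scope.
Local Open Scope ring_scope.

Set Implicit Arguments.
Unset Strict Implicit.
Unset Printing Implicit Defensive.

(** The Heisenberg translations and the anisotropic dilations form a group of
    affine automorphisms that acts simply transitively on the Siegel domain,
    and the operator commutes with it.  Write [height z] for rho(z,z), and use
    (eta, (s, tau)) as coordinates around the base point (0, i), with s the
    height.  The group element that sends the base point to z is
    [transport z]; it has Jacobian height(z)^(n+2), it multiplies heights by
    height(z), and the kernel T_kernel alpha z pulls back to
    height(z)^-(n+2) times a function [kernel0] that does not depend on z.
    Hence, up to the constant in front,
      (T f)(z) = integral of kernel0(w) f(transport z w) dw,
    which is a convolution with a positive kernel on the group.  Three facts
    follow.

    Eigenfunctions.  T maps height^-b to c(b) height^-b, with c(b) the integral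
    of kernel0 against s^-b ([integral_T_kernel_height]).  Integrating over tau,
    then s, then eta, the integrand is each time a power of B + phi, where phi
    is tau^2, s or |eta|^2.  As the integral of e^(-v phi) is a pure power of v
    in these cases, each step brings a quotient of values of the Gamma function
    ([integral_laplace]); the duplication formula
    ([Gamma_duplication]) collapses the product to [kernel_const], and c(b) is
    invariant under b <-> 1 + alpha - b.

    Upper bound.  The Schur test ([schur_test]) with the weight height^(-1/p)
    has a first condition about b = 1/p.  Since |rho(z,w)| is symmetric, the
    transposed kernel differs only by powers of the heights, and the second
    condition is about b = 1 + alpha - 1/p, which gives the same constant
    ([normLp_T_op_le]).  The hypothesis p (1 + alpha) > 1 says that 1/p lies in
    the interval (0, 1 + alpha) on which c is finite.

    Lower bound.  For f = height^(-1/p) 1_E the p-th power of the norm is the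
    measure of E for dV / height, which is the Haar measure invariant under the
    maps z |-> transport z w.  The group is solvable, hence amenable: for every
    box B around the base point there are boxes E' inside E such that
    transport z maps B into E for all z in E' ([inbox_transport]) and such that
    the measures of E' and E have a quotient as close to 1 as desired
    ([mass_shrink]).  On E' the function T f is at least height^(-1/p) times
    the part of c(1/p) carried by B, and that part tends to c(1/p) as B grows
    ([cvg_box_const]). *)

(** * Affine substitutions and truncated powers on the line *)

Section Affine.
Context (R : realType).
Notation mu := (@lebesgue_measure R).
Variables (a b : R).
Hypothesis a0 : 0 < a.

Definition affine (x : R) : R := a * x + b.

Lemma measurable_affine : measurable_fun [set: R] affine.
Proof. by apply: measurable_funD => //; exact: measurable_funM. Qed.

Lemma affine_preimage_ocitv (c d : R) :
  affine @^-1` `]c, d] = `](c - b) / a, (d - b) / a]%classic.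
Proof.
apply/seteqP; split => x /=; rewrite !in_itv/= /affine ltr_pdivrMr// ler_pdivlMr//;
 rewrite (mulrC x) => /andP[h1 h2]; apply/andP; split; lra.
Qed.

(** Rescaled by a, the image of Lebesgue measure under x |-> a x + b gives each
    interval its length, and this characterises Lebesgue measure. *)
Lemma integral_affine (f : R -> \bar R) : measurable_fun [set: R] f ->
  (forall x, 0 <= f x)%E ->
  (\int[mu]_x f (a * x + b)%R = (a^-1)%:E * \int[mu]_x f x)%E.
Proof.
move=> mf f0.
pose pf : {measure set (measurableTypeR R) -> \bar R} :=
  @measure_function_pushforward__canonical__measure_function_Measure _ _
    (measurableTypeR R) (measurableTypeR R) R mu _ measurable_affine.
have E : (\int[mu]_x f (a * x + b)%R = \int[pf]_x f x)%E.
  by rewrite ge0_integral_pushforward//; exact: measurable_affine.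
rewrite E.
have a1 : 0 <= a^-1 by rewrite invr_ge0 ltW.
rewrite -(@ge0_integral_mscale _ _ R mu setT measurableT (NngNum a1) f)//.
apply: eq_measure_integral => /= A mA _.
have H : mu A = mscale (NngNum (ltW a0)) pf A.
  apply: (@lebesgue_measure_unique _ (mscale (NngNum (ltW a0)) pf)) => //= _ [[c d]] _ <-.
  rewrite /= /mscale/= /pushforward affine_preimage_ocitv !lebesgue_measure_itv/= !lte_fin.
  rewrite ltr_pM2r ?invr_gt0// ltrD2r; case: ifP => _; last by rewrite mule0.
  by rewrite !EFinN -!EFinB -EFinM; congr EFin; field; rewrite gt_eqF.
by rewrite /mscale/= H /mscale/= muleA -EFinM mulVf ?gt_eqF// mul1e.
Qed.

End Affine.

(** The truncated power x_+^a.  Being 0 off the positive half-line, it turns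
    integrals over half-lines into integrals over R, to which affine
    substitutions and Tonelli apply without tracking domains. *)
Definition posp (R : realType) (a x : R) : R := if 0 < x then x `^ a else 0.

Section Posp.
Context (R : realType).
Implicit Types a b c x : R.

Lemma posp_ge0 a x : 0 <= posp a x.
Proof. by rewrite /posp; case: ifP => // _; exact: powR_ge0. Qed.

Lemma posp_gt0E a x : 0 < x -> posp a x = x `^ a.
Proof. by rewrite /posp => ->. Qed.

Lemma posp_le0E a x : x <= 0 -> posp a x = 0.
Proof. by rewrite /posp leNgt => /negbTE ->. Qed.

Lemma measurable_posp a : measurable_fun [set: R] (posp a).
Proof.
have m1 : measurable_fun [set: R] (fun x : R => 0 < x) by exact: measurable_fun_ltr.
have m2 : measurable_fun [set: R] (fun x : R => x `^ a) by exact: measurable_powR.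
exact: measurable_fun_ifT m1 m2 _.
Qed.

Lemma pospM c x a : 0 < c -> posp a (c * x) = c `^ a * posp a x.
Proof.
move=> c0; rewrite /posp pmulr_rgt0//; case: ifP => [x0|_]; last by rewrite mulr0.
by rewrite powRM// ltW.
Qed.

Lemma pospD a b x : posp (a + b) x = posp a x * posp b x.
Proof.
rewrite /posp; case: ifP => [x0|_]; last by rewrite mulr0.
by rewrite powRD// (gt_eqF x0) implybT.
Qed.

End Posp.

(** * The Gamma function *)

Section GammaFun.
Context (R : realType).
Notation mu := (@lebesgue_measure R).
Implicit Types s : R.

(** H is bounded and increasing on the positive half-line, and its derivative h
    has the order of v^(s-1) near 0: a multiple of h dominates the Gamma
    integrand, which gives convergence at both ends at once. *)
Let h s (v : R) : R := s * v `^ (s - 1) / (1 + v `^ s) ^+ 2.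
Let H s (v : R) : R := - (1 + v `^ s)^-1.

Let den0 s (v : R) : 0 < 1 + v `^ s.
Proof. by rewrite ltr_pwDl// powR_ge0. Qed.

Let is_derive_H s (v : R) : 0 < v -> is_derive v 1 (H s) (h s v).
Proof.
move=> v0.
have d1 : is_derive v 1 (fun x => 1 + x `^ s) (s * v `^ (s - 1)).
  have := is_derive1_powR s v0 => d.
  have dd := is_deriveD (is_derive_cst (1 : R) v 1) d.
  by apply: (is_derive_eq dd); rewrite add0r.
have nz : 1 + v `^ s != 0 by rewrite gt_eqF.
have d2 := @is_deriveV _ (fun x : R => 1 + x `^ s) v _ _ nz d1.
have d3 := is_deriveN d2.
apply: is_derive_eq d3 _.
by rewrite /h scaleNr opprK /GRing.scale/= mulrC.
Qed.

Let integral_h s (e : R) : 0 < s -> 0 < e ->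
  (\int[mu]_(v in `[e, +oo[) (h s v)%:E <= 1%:E)%E.
Proof.
move=> s0 e0.
have ch v : 0 < v -> {for v, continuous (h s)}.
  move=> v0; apply: continuousM.
    apply: continuousM; first exact: cst_continuous.
    by apply/differentiable_continuous/derivable1_diffP/derivable_powR; rewrite in_itv/= v0.
  have cc : {for v, continuous (fun x => (1 + x `^ s))}.
    apply: continuousD; first exact: cst_continuous.
    by apply/differentiable_continuous/derivable1_diffP/derivable_powR; rewrite in_itv/= v0.
  apply: continuousV; first by rewrite expf_neq0// gt_eqF.
  by apply: (@continuous_comp _ _ _ (fun x : R => 1 + x `^ s) (fun x : R => x ^+ 2)) => //; exact: exprn_continuous.
rewrite (@ge0_continuous_FTC2y _ (h s) (H s) e 0)//.
- by rewrite -EFinB lee_fin sub0r /H opprK invf_le1// lerDl powR_ge0.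
- by move=> x ex; rewrite /h divr_ge0// ?sqr_ge0// mulr_ge0 ?powR_ge0// ltW.
- apply/continuous_within_itvcyP; split.
    by move=> x; rewrite in_itv/= andbT => ex; apply: ch; exact: lt_trans ex.
  by apply: cvg_at_right_filter; apply: ch.
- rewrite -[X in _ --> X]oppr0; apply: cvgN.
  apply/gtr0_cvgV0; first by near=> x; exact: den0.
  apply/cvgryPge => A; near=> x.
  have x1 : (`|A| + 1) `^ s^-1 <= x by near: x; exact: nbhs_pinfty_ge.
  have : ((`|A| + 1) `^ s^-1) `^ s <= x `^ s.
    by apply: ge0_ler_powR; rewrite ?nnegrE ?powR_ge0 ?(ltW s0)// (le_trans _ x1)// powR_ge0.
  rewrite -powRrM mulVf ?gt_eqF// powRr1 ?addr_ge0// => xs.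
  by apply: (le_trans (ler_norm A)); lra.
- by move=> x ex; have [] := is_derive_H s (lt_trans e0 ex).
- apply: cvg_at_right_filter.
  have [d _] := is_derive_H s e0.
  by apply/differentiable_continuous/derivable1_diffP.
- by move=> x; rewrite in_itv/= andbT => ex; rewrite derive1E; have [_ ->] := is_derive_H s (lt_trans e0 ex).
Unshelve. all: end_near. Qed.

(** It suffices that (1 + v^s)^2 is bounded by a multiple of e^v, and
    v^s <= (2s)^s e^(v/2) since v/(2s) <= e^(v/(2s)). *)
Let h_dom s v : 0 < s -> 0 < v ->
  v `^ (s - 1) * expR (- v) <= ((1 + (2 * s) `^ s) ^+ 2 / s) * h s v.
Proof.
move=> s0 v0.
have s20 : 0 < 2 * s by rewrite mulr_gt0.
have H1 : v `^ s <= (2 * s) `^ s * expR (v / 2).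
  have -> : expR (v / 2) = (expR (v / (2 * s))) `^ s.
    by rewrite -expRM; congr expR; field; rewrite gt_eqF.
  rewrite -powRM ?expR_ge0// ?(ltW s20)//; apply: ge0_ler_powR; rewrite ?nnegrE.
  - exact: ltW.
  - exact: ltW.
  - by rewrite mulr_ge0 ?expR_ge0// ltW.
  rewrite -ler_pdivrMl// mulrC; apply: le_trans (expR_ge1Dx _).
  by rewrite lerDr.
have H2 : 1 + v `^ s <= (1 + (2 * s) `^ s) * expR (v / 2).
  rewrite mulrDl mul1r lerD// -expR0 ler_expR divr_ge0// ltW//.
have H3 : (1 + v `^ s) ^+ 2 <= (1 + (2 * s) `^ s) ^+ 2 * expR v.
  have -> : expR v = expR (v / 2) ^+ 2 by rewrite -expRM_natr; congr expR; field.
  by rewrite -exprMn ler_pXn2r// nnegrE ?mulr_ge0 ?addr_ge0 ?powR_ge0 ?expR_ge0.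
rewrite /h expRN [X in _ <= X](_ : _ = v `^ (s - 1) * ((1 + (2 * s) `^ s) ^+ 2 / (1 + v `^ s) ^+ 2)); last first.
  by field; rewrite !gt_eqF.
rewrite ler_wpM2l ?powR_ge0// -div1r ler_pdivlMr ?exprn_gt0//.
by rewrite mulrAC mul1r ler_pdivrMr ?expR_gt0.
Qed.

Lemma measurable_gammafun s :
  measurable_fun [set: R] (fun v => posp (s - 1) v * expR (- v)).
Proof.
apply: measurable_funM; first exact: measurable_posp.
by apply: measurableT_comp => //; exact: measurable_funN.
Qed.

Lemma gammafun_ge0 s v : 0 <= posp (s - 1) v * expR (- v).
Proof. by rewrite mulr_ge0 ?posp_ge0 ?expR_ge0. Qed.

Let bigcup_itvcy : \bigcup_(k : nat) `[(k.+1%:R^-1 : R), +oo[%classic = `]0%R, +oo[%classic.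
Proof.
apply/seteqP; split => x /=.
  move=> [k _] /=; rewrite !in_itv/= !andbT; apply: lt_le_trans.
  by rewrite invr_gt0 ltr0n.
rewrite in_itv/= andbT => x0.
exists (Num.truncn x^-1) => //=; rewrite in_itv/= andbT.
rewrite -[leRHS]invrK lef_pV2 ?posrE ?invr_gt0//.
by apply/ltW; rewrite truncnS_gt.
Qed.

Lemma integral_gammafun_itv s :
  (\int[mu]_v (posp (s - 1) v * expR (- v))%:E =
   \int[mu]_(v in `]0%R, +oo[) (posp (s - 1) v * expR (- v))%:E)%E.
Proof.
rewrite [RHS]integral_mkcond; apply: eq_integral => v _.
rewrite patchE; case: ifPn => //; rewrite notin_setE/= in_itv/= andbT => /negP.
by rewrite -leNgt => v0; rewrite posp_le0E// mul0r.
Qed.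

Lemma integral_gammafun_lty s : 0 < s ->
  (\int[mu]_v (posp (s - 1) v * expR (- v))%:E < +oo)%E.
Proof.
move=> s0; rewrite integral_gammafun_itv -bigcup_itvcy.
set K := (1 + (2 * s) `^ s) ^+ 2 / s.
have K0 : 0 <= K by rewrite divr_ge0 ?sqr_ge0// ltW.
have mgE D : measurable_fun D (fun v => (posp (s - 1) v * expR (- v))%:E).
  by apply/measurable_funTS/measurable_EFinP; exact: measurable_gammafun.
have mhE : measurable_fun [set: R] (fun v => (h s v)%:E).
  apply/measurable_EFinP; apply: measurable_funM.
    by apply: measurable_funM => //; exact: measurable_powR.
  have m1 : measurable_fun [set: R] (fun v : R => 1 + v `^ s).
    by apply: measurable_funD => //; exact: measurable_powR.
  have m2 : measurable_fun [set: R] (fun v : R => (1 + v `^ s) ^+ 2) by exact: measurable_funX.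
  under eq_fun do rewrite -powR_inv1 ?sqr_ge0//.
  by apply: (@measurableT_comp _ _ _ _ _ _ (@powR R ^~ (-1))) => //; exact: measurable_powR.
have bnd k : (\int[mu]_(v in `[(k.+1%:R^-1)%R, +oo[) (posp (s - 1) v * expR (- v))%:E <= K%:E)%E.
  have k0 : 0 < k.+1%:R^-1 :> R by rewrite invr_gt0 ltr0n.
  apply: (@le_trans _ _ (\int[mu]_(v in `[(k.+1%:R^-1)%R, +oo[) (K%:E * (h s v)%:E))%E).
    apply: ge0_le_integral => //.
    - by move=> v _; rewrite lee_fin gammafun_ge0.
    - exact: mgE.
    - by apply: measurable_funTS; apply: measurable_funeM.
    - move=> v; rewrite /= in_itv/= andbT => kv.
      have v0 : 0 < v by exact: lt_le_trans kv.
      by rewrite -EFinM lee_fin posp_gt0E// h_dom.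
  rewrite ge0_integralZl_EFin//; last 2 first.
  - move=> v; rewrite /= in_itv/= andbT => kv.
    have v0 : 0 < v by exact: lt_le_trans kv.
    by rewrite lee_fin /h divr_ge0 ?sqr_ge0// mulr_ge0 ?powR_ge0// ltW.
  - exact: measurable_funTS.
  by rewrite -[leRHS]mule1 lee_pmul2l ?integral_h// lte_fin /K divr_gt0// exprn_gt0.
apply: (@le_lt_trans _ _ K%:E); last by rewrite ltry.
apply: (@cvge_le nat \oo _ R
  (fun k => \int[mu]_(v in `[(k.+1%:R^-1)%R, +oo[) (posp (s - 1) v * expR (- v))%:E)%E).
  by apply: nearW => k; exact: bnd.
apply: ge0_nondecreasing_set_cvg_integral => //.
- apply/nondecreasing_seqP => k; rewrite subsetEset => v /=; rewrite !in_itv/= !andbT.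
  by apply: le_trans; rewrite lef_pV2 ?posrE ?ltr0n// ler_nat.
- by move=> k; exact: mgE.
- by move=> k v _; rewrite lee_fin gammafun_ge0.
Qed.

Let integral_gammafun_gt0 s : 0 < s ->
  (0 < \int[mu]_v (posp (s - 1) v * expR (- v))%:E)%E.
Proof.
move=> s0.
(* On [1, 2] the integrand is at least e^-2 / 2. *)
pose c : R := expR (- 2) / 2.
have c0 : 0 < c by rewrite divr_gt0// expR_gt0.
apply: (@lt_le_trans _ _ (\int[mu]_(v in `[1%R, 2%R]) c%:E)%E).
  rewrite integral_cst//; apply: mule_gt0; first by rewrite lte_fin.
  have := lebesgue_measure_itv (`[1%R, 2%R] : interval R) => /= ->.
  by rewrite lte_fin ltr1n -EFinB lte_fin subr_gt0 ltr1n.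
rewrite integral_mkcond; apply: ge0_le_integral => //.
- by move=> v _; apply: erestrict_ge0 => w _; rewrite lee_fin ltW.
- by apply: (measurable_restrictT _ _).1 => //; exact: measurable_cst.
- by apply/measurable_EFinP; exact: measurable_gammafun.
- move=> v _; rewrite patchE; case: ifPn; last by rewrite lee_fin gammafun_ge0.
  rewrite inE/= in_itv/= => /andP[v1 v2]; rewrite lee_fin.
  have v0 : 0 < v by exact: lt_le_trans v1.
  rewrite posp_gt0E// mulrC /c; apply: ler_pM; rewrite ?expR_ge0 ?invr_ge0//.
    by rewrite ler_expR lerN2.
  rewrite powRB; last by rewrite (gt_eqF v0) implybT.
  rewrite powRr1 ?(ltW v0)// -[leLHS]mul1r; apply: ler_pM => //.
  - by have := @ge0_ler_powR R s (ltW s0) 1 v; rewrite powR1; apply; rewrite ?nnegrE// (ltW v0).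
  - by rewrite lef_pV2 ?posrE.
Qed.

(** [Gamma] is a real number extracted from an extended-real integral; since
    the latter converges, the equality holds for extended reals. *)
Lemma GammaE s : 0 < s ->
  (\int[mu]_v (posp (s - 1) v * expR (- v))%:E)%E = (Gamma s)%:E.
Proof.
move=> s0; rewrite /Gamma /Rintegral.
have -> : (\int[mu]_(t in `]0%R, +oo[) (t `^ (s - 1) * expR (- t))%:E =
  \int[mu]_v (posp (s - 1) v * expR (- v))%:E)%E.
  rewrite integral_gammafun_itv; apply: eq_integral => v.
  by rewrite inE/= in_itv/= andbT => v0; rewrite posp_gt0E.
rewrite fineK// ge0_fin_numE ?integral_gammafun_lty//.
by apply: integral_ge0 => v _; rewrite lee_fin gammafun_ge0.
Qed.

#[global] Opaque Gamma.

Lemma Gamma_gt0 s : 0 < s -> 0 < Gamma s.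
Proof. by move=> s0; rewrite -lte_fin -GammaE// integral_gammafun_gt0. Qed.

(** This is the substitution v |-> l v in the integral that defines Gamma. *)
Lemma integral_gamma_scale s l : 0 < s -> 0 < l ->
  (\int[mu]_v (posp (s - 1) v * expR (- (l * v)))%:E)%E = (Gamma s * l `^ (- s))%:E.
Proof.
move=> s0 l0.
have := @integral_affine R l 0 l0 (fun v => (posp (s - 1) v * expR (- v))%:E).
move=> /(_ (proj2 (measurable_EFinP _ _) (measurable_gammafun s))) E.
have {}E := E (fun v => gammafun_ge0 s v).
move: E; rewrite GammaE// => E.
have E2 : (\int[mu]_x (posp (s - 1) (l * x + 0)%R * expR (- (l * x + 0)%R))%:E =
  (l `^ (s - 1))%:E * \int[mu]_v (posp (s - 1) v * expR (- (l * v)))%:E)%E.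
  rewrite -ge0_integralZl_EFin ?powR_ge0//.
  - by apply: eq_integral => x _; rewrite addr0 pospM// -EFinM mulrA.
  - by move=> x _; rewrite lee_fin mulr_ge0 ?posp_ge0 ?expR_ge0.
  - apply/measurable_EFinP; apply: measurable_funM; first exact: measurable_posp.
    by apply: measurableT_comp => //; apply: measurable_funN; exact: measurable_funM.
have lp : l `^ (s - 1) != 0 by rewrite gt_eqF// powR_gt0.
rewrite E2 in E.
have := congr1 (fun x => ((l `^ (s - 1))^-1)%:E * x)%E E.
rewrite muleA -EFinM mulVf// mul1e -!EFinM => ->.
congr EFin; rewrite mulrA mulrC; congr (_ * _).
rewrite powRB ?(gt_eqF l0) ?implybT// powRr1 ?ltW// powRN.
by field; rewrite !gt_eqF// powR_gt0.
Qed.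

End GammaFun.

Ltac meas1 := lazymatch goal with
  | |- measurable_fun _ (posp _) => exact: measurable_posp
  | |- measurable_fun _ (@expR _) => exact: measurable_expR
  | |- measurable_fun _ (@GRing.opp _) => exact: oppr_measurable
  | |- measurable_fun _ (fun _ => ?c) => exact: measurable_cst
  | |- measurable_fun _ (fun x => x) => exact: measurable_id
  | |- measurable_fun _ (fun x => fst x) => exact: measurable_fst
  | |- measurable_fun _ (fun x => snd x) => exact: measurable_snd
  | |- measurable_fun _ (fun x => @?f x + - @?g x) => apply: measurable_funB
  | |- measurable_fun _ (fun x => @?f x + @?g x) => apply: measurable_funD
  | |- measurable_fun _ (fun x => @?f x * @?g x) => apply: measurable_funM
  | |- measurable_fun _ (fun x => - @?f x) => apply: measurable_funN
  | |- measurable_fun _ (fun x => @?f x ^+ _) => apply: measurable_funX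
  | |- measurable_fun _ (fun x => expR (@?f x)) =>
      apply: (@measurableT_comp _ _ _ _ _ _ expR _ f (@measurable_expR _))
  | |- measurable_fun _ (fun x => posp ?a (@?f x)) =>
      apply: (@measurableT_comp _ _ _ _ _ _ (posp a) _ f (@measurable_posp _ a))
  | |- measurable_fun _ (fun x => (@?f x) `^ ?a) =>
      apply: (@measurableT_comp _ _ _ _ _ _ (fun y => powR y a) _ f (@measurable_powR _ a))
  end.
Ltac meas := repeat first [ assumption | meas1 ].

Section Laplace.
Context d (X : measurableType d) (R : realType).
Variable m : {sigma_finite_measure set X -> \bar R}.
Variables (g phi : X -> R) (C e : R).
Hypotheses (mg : measurable_fun [set: X] g) (mphi : measurable_fun [set: X] phi).
Hypotheses (g0 : forall x, 0 <= g x) (phi0 : forall x, 0 <= phi x).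
Hypothesis H : forall v, 0 < v ->
  (\int[m]_x (g x * expR (- (v * phi x)))%:E)%E = (C * v `^ (- e))%:E.
Notation mu := (@lebesgue_measure R).

(** Write (B + phi)^-q as Gamma(q)^-1 times the integral of
    v^(q-1) e^(-(B + phi) v), exchange the integrals, and evaluate the inner one
    with the hypothesis on the Laplace transform of [g] along [phi]; what
    remains is another Gamma integral, in v^(q-e-1) e^(-B v). *)
Lemma integral_laplace (B q : R) : 0 < B -> 0 < q -> e < q ->
  (\int[m]_x (g x * (B + phi x) `^ (- q))%:E)%E =
  (C * (Gamma (q - e) / Gamma q) * B `^ (e - q))%:E.
Proof.
move=> B0 q0 eq.
have Gq := Gamma_gt0 q0.
have C0 : 0 <= C.
  have : (0 <= (C * 1 `^ (- e))%:E)%E.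
    rewrite -H//; apply: integral_ge0 => x _.
    by rewrite lee_fin mulr_ge0 ?expR_ge0.
  by rewrite powR1 mulr1 lee_fin.
have Bp x : 0 < B + phi x by rewrite ltr_pwDl.
pose K (z : X * R) : \bar R :=
  (g z.1 * (posp (q - 1) z.2 * expR (- ((B + phi z.1) * z.2))))%:E.
have K0 z : (0 <= K z)%E by rewrite lee_fin !mulr_ge0 ?posp_ge0 ?expR_ge0.
have mK : measurable_fun setT K.
  have mg1 : measurable_fun setT (fun z : X * R => g z.1) by exact: (measurableT_comp mg).
  have mp1 : measurable_fun setT (fun z : X * R => phi z.1) by exact: (measurableT_comp mphi).
  by apply/measurable_EFinP; meas.
have F1 x : (\int[mu]_v K (x, v))%E = (Gamma q * (g x * (B + phi x) `^ (- q)))%:E.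
  rewrite /K /=; under eq_integral do rewrite EFinM.
  rewrite ge0_integralZl_EFin//.
  - by rewrite integral_gamma_scale// -EFinM; congr EFin; ring.
  - by move=> v _; rewrite lee_fin mulr_ge0 ?posp_ge0 ?expR_ge0.
  - by apply/measurable_EFinP; meas.
have F2 v : (\int[m]_x K (x, v))%E =
    (C * (posp (q - e - 1) v * expR (- (B * v))))%:E.
  rewrite /K /=; have [v0|v0] := ltP 0 v; last first.
    rewrite !(posp_le0E _ v0) mul0r mulr0; apply: integral0_eq => x _.
    by rewrite mul0r mulr0.
  transitivity (\int[m]_x ((posp (q - 1) v * expR (- (B * v)))%:E *
      (g x * expR (- (v * phi x)))%:E))%E.
    apply: eq_integral => x _; rewrite -EFinM; congr EFin.
    by rewrite mulrDl opprD expRD (mulrC v); ring.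
  rewrite ge0_integralZl_EFin//; last 3 first.
  - by move=> x _; rewrite lee_fin mulr_ge0 ?expR_ge0.
  - by apply/measurable_EFinP; meas.
  - by rewrite mulr_ge0 ?posp_ge0 ?expR_ge0.
  rewrite H// -EFinM; congr EFin; rewrite !posp_gt0E//.
  rewrite (_ : q - e - 1 = q - 1 + - e); last by ring.
  by rewrite (powRD (x := v) (r := q - 1)) ?(gt_eqF v0) ?implybT//; ring.
have := @fubini_tonelli _ _ X (measurableTypeR R) R m mu K mK K0.
under eq_integral do rewrite F1.
under [X in _ = X -> _]eq_integral do rewrite F2.
under eq_integral do rewrite EFinM.
under [X in _ = X -> _]eq_integral do rewrite EFinM.
rewrite !ge0_integralZl_EFin//; last 5 first.
- by move=> v _; rewrite lee_fin mulr_ge0 ?posp_ge0 ?expR_ge0.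
- by apply/measurable_EFinP; meas.
- by move=> x _; rewrite lee_fin mulr_ge0 ?powR_ge0.
- by apply/measurable_EFinP; meas.
- exact: ltW.
rewrite integral_gamma_scale ?subr_gt0// => E.
have := congr1 (fun x => ((Gamma q)^-1)%:E * x)%E E.
rewrite muleA -!EFinM mulVf ?gt_eqF// mul1e => ->.
by congr EFin; rewrite opprB; field; rewrite gt_eqF.
Qed.

End Laplace.

(** * Gaussian integrals and the duplication formula *)

Section Gauss.
Context (R : realType).
Notation mu := (@lebesgue_measure R).

Lemma integral_gauss_scale (v : R) : 0 < v ->
  (\int[mu]_t (expR (- (v * t ^+ 2)))%:E)%E = (Num.sqrt pi * v `^ (- 2^-1))%:E.
Proof.
move=> v0.
have sv0 : 0 < Num.sqrt v by rewrite sqrtr_gt0.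
have := @integral_affine R (Num.sqrt v) 0 sv0 (fun t => (gauss_fun t)%:E).
move=> /(_ (proj2 (measurable_EFinP _ _) (@measurable_gauss_fun R))) E.
have {}E := E (fun t => gauss_fun_ge0 t).
rewrite integralT_gauss in E; rewrite powRN powR12_sqrt ?(ltW v0)// mulrC EFinM -E.
apply: eq_integral => t _; congr EFin; rewrite /gauss_fun addr0 exprMn sqr_sqrtr//.
exact: ltW.
Qed.

Lemma posp_1Bsqr (a s : R) : posp a (1 + s) * posp a (1 - s) = posp a (1 - s ^+ 2).
Proof.
rewrite /posp; have -> : 1 - s ^+ 2 = (1 + s) * (1 - s) by ring.
have [h1|h1] := ltP 0 (1 + s); have [h2|h2] := ltP 0 (1 - s).
- by rewrite mulr_gt0// powRM// ltW.
- by rewrite pmulr_rgt0// ltNge h2 mulr0.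
- by rewrite pmulr_lgt0// ltNge h1 mul0r.
- by rewrite mul0r; case: ifP => // /ltW hh; exfalso; nra.
Qed.

(** I(x) is the Beta value B(x, 1/2).  Its two evaluations below give the
    duplication formula; they use only affine substitutions and Tonelli. *)
Let I x : \bar R := (\int[mu]_s (posp (x - 1) (1 - s ^+ 2))%:E)%E.

Let I_ge0 x : (0 <= I x)%E.
Proof. by apply: integral_ge0 => s _; rewrite lee_fin posp_ge0. Qed.

Let I_scale x (a : R) : 0 < a ->
  (\int[mu]_t (posp (x - 1) (a - t ^+ 2))%:E = (a `^ (x - 2^-1))%:E * I x)%E.
Proof.
move=> a0.
have sa0 : 0 < (Num.sqrt a)^-1 by rewrite invr_gt0 sqrtr_gt0.
have mP : measurable_fun setT (fun s : R => (posp (x - 1) (1 - s ^+ 2))%:E).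
  by apply/measurable_EFinP; meas.
have E : (\int[mu]_t (posp (x - 1) (a - t ^+ 2))%:E =
    \int[mu]_t ((a `^ (x - 1))%:E * (posp (x - 1) (1 - ((Num.sqrt a)^-1 * t + 0) ^+ 2))%:E))%E.
  apply: eq_integral => t _; rewrite -EFinM -pospM//; congr (_ _)%:E.
  by rewrite addr0 exprMn exprVn sqr_sqrtr ?(ltW a0)//; field; rewrite gt_eqF.
rewrite E ge0_integralZl_EFin; last 4 first.
- by [].
- by move=> t _; rewrite lee_fin posp_ge0.
- by apply/measurable_EFinP; meas.
- exact: powR_ge0.
rewrite (integral_affine 0 sa0 mP) ?invrK//; last by move=> s; rewrite lee_fin posp_ge0.
rewrite muleA -EFinM -powR12_sqrt ?(ltW a0)// -powRD ?(gt_eqF a0) ?implybT//.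
by congr ((_ `^ _)%:E * _)%E; field.
Qed.

(** Integrate e^-a (a - t^2)_+^(x-1) over the plane: over t first, scaling t by
    the square root of a gives Gamma(x + 1/2) I(x); over a first, translating a
    by t^2 gives a Gaussian times Gamma(x). *)
Let Gamma_half x : 0 < x ->
  ((Gamma (x + 2^-1))%:E * I x = (Num.sqrt pi * Gamma x)%:E)%E.
Proof.
move=> x0.
pose K (z : R * R) : \bar R := (expR (- z.1) * posp (x - 1) (z.1 - z.2 ^+ 2))%:E.
have K0 z : (0 <= K z)%E by rewrite lee_fin mulr_ge0 ?posp_ge0 ?expR_ge0.
have mK : measurable_fun setT K by apply/measurable_EFinP; meas.
have xh : 0 < x + 2^-1 by rewrite addr_gt0.
rewrite -GammaE// muleC -ge0_integralZl//; last 2 first.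
- by apply/measurable_EFinP; meas.
- by move=> v _; rewrite lee_fin mulr_ge0 ?posp_ge0 ?expR_ge0.
transitivity (\int[mu]_a \int[mu]_t K (a, t))%E.
  apply: eq_integral => a _; rewrite /K /=.
  have [a0|a0] := ltP 0 a; last first.
    rewrite posp_le0E// mul0r mule0; apply/esym/integral0_eq => t _.
    by rewrite posp_le0E ?mulr0// subr_le0 (le_trans a0)// sqr_ge0.
  under eq_integral do rewrite EFinM.
  rewrite ge0_integralZl_EFin ?expR_ge0//; last 2 first.
  - by move=> t _; rewrite lee_fin posp_ge0.
  - by apply/measurable_EFinP; meas.
  rewrite I_scale// posp_gt0E//.
  rewrite (_ : x + 2^-1 - 1 = x - 2^-1); last by field.
  by rewrite muleC [in LHS]mulrC EFinM -muleA.
rewrite (@fubini_tonelli _ _ (measurableTypeR R) (measurableTypeR R) R mu mu K mK K0).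
transitivity (\int[mu]_t ((Gamma x)%:E * (gauss_fun t)%:E))%E; last first.
  rewrite ge0_integralZl_EFin ?ltW ?Gamma_gt0//.
  - by rewrite integralT_gauss -EFinM mulrC.
  - by move=> t _; rewrite lee_fin gauss_fun_ge0.
  - by apply/measurable_EFinP; exact: measurable_gauss_fun.
apply: eq_integral => t _; rewrite /K/=.
have mk : measurable_fun setT (fun a : R => (expR (- a) * posp (x - 1) (a - t ^+ 2))%:E).
  by apply/measurable_EFinP; meas.
have := integral_affine (t ^+ 2) ltr01 mk; rewrite invr1 mul1e => <-; last first.
  by move=> a; rewrite lee_fin mulr_ge0 ?posp_ge0 ?expR_ge0.
rewrite -GammaE// muleC -ge0_integralZl_EFin ?gauss_fun_ge0//; last 2 first.
- by move=> v _; rewrite lee_fin mulr_ge0 ?posp_ge0 ?expR_ge0.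
- by apply/measurable_EFinP; meas.
apply: eq_integral => c _; rewrite -EFinM mul1r addrK opprD expRD /gauss_fun.
by congr EFin; ring.
Qed.

(** Gamma(x)^2 is the integral of the self-convolution of a_+^(x-1) e^-a, and
    the substitution a = p (1 + s) / 2 in the convolution at p yields I(x). *)
Let Gamma_sqr x : 0 < x ->
  ((Gamma x ^+ 2)%:E = (2 `^ (1 - 2 * x) * Gamma (2 * x))%:E * I x)%E.
Proof.
move=> x0.
have x20 : 0 < 2 * x by rewrite mulr_gt0.
pose f (a : R) := posp (x - 1) a * expR (- a).
have f0 a : 0 <= f a by rewrite mulr_ge0 ?posp_ge0 ?expR_ge0.
have mf : measurable_fun setT f by rewrite /f; meas.
pose K (z : R * R) : \bar R := (f z.1 * f (z.2 - z.1))%:E.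
have K0 z : (0 <= K z)%E by rewrite lee_fin mulr_ge0.
have mK : measurable_fun setT K.
  by apply/measurable_EFinP; apply: measurable_funM; apply: (measurableT_comp mf); meas.
have E1 a : (\int[mu]_p K (a, p) = (Gamma x)%:E * (f a)%:E)%E.
  rewrite /K/=; under eq_integral do rewrite EFinM.
  rewrite ge0_integralZl_EFin//; last 2 first.
  - by move=> t _; rewrite lee_fin.
  - by apply/measurable_EFinP; apply: (measurableT_comp mf); meas.
  have mk : measurable_fun setT (fun p : R => (f p)%:E) by apply/measurable_EFinP.
  have f0E p : (0 <= (f p)%:E)%E by rewrite lee_fin.
  have := integral_affine (- a) ltr01 mk f0E; rewrite invr1 mul1e GammaE// => E.
  rewrite muleC; transitivity ((\int[mu]_p (f (1 * p - a))%:E) * (f a)%:E)%E; last by rewrite E.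
  by congr (_ * _)%E; apply: eq_integral => p _; rewrite mul1r.
have E2 p : (\int[mu]_a K (a, p) = I x * ((2 `^ (1 - 2 * x)) * (posp (2 * x - 1) p * expR (- p)))%:E)%E.
  rewrite /K/=; have [p0|p0] := ltP 0 p; last first.
    rewrite posp_le0E// mul0r mulr0 mule0; apply: integral0_eq => a _.
    rewrite /f; have [a0|a0] := ltP 0 a; last by rewrite posp_le0E// !mul0r.
    by rewrite (@posp_le0E _ _ (p - a)) ?mul0r ?mulr0// subr_le0 (le_trans p0)// ltW.
  have p20 : 0 < p / 2 by rewrite divr_gt0.
  have mk : measurable_fun setT (fun a : R => (f a * f (p - a))%:E).
    by apply/measurable_EFinP; apply: measurable_funM => //; apply: (measurableT_comp mf); meas.
  have := integral_affine (p / 2) p20 mk.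
  move=> /(_ (fun a => mulr_ge0 (f0 a) (f0 (p - a)))).
  have -> : (\int[mu]_s (f (p / 2 * s + p / 2)%R * f (p - (p / 2 * s + p / 2)))%:E =
     ((p / 2) `^ (2 * (x - 1)) * expR (- p))%:E * I x)%E.
    rewrite -ge0_integralZl_EFin; last 4 first.
    - by [].
    - by move=> s _; rewrite lee_fin posp_ge0.
    - by apply/measurable_EFinP; meas.
    - by rewrite mulr_ge0 ?powR_ge0 ?expR_ge0.
    apply: eq_integral => s _; rewrite -EFinM -posp_1Bsqr; congr EFin.
    rewrite /f (_ : p / 2 * s + p / 2 = p / 2 * (1 + s)); last by ring.
    rewrite (_ : p - p / 2 * (1 + s) = p / 2 * (1 - s)); last by field.
    rewrite !pospM//.
    have -> : (p / 2) `^ (2 * (x - 1)) = (p / 2) `^ (x - 1) * (p / 2) `^ (x - 1).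
      by rewrite -powRD ?(gt_eqF p20) ?implybT//; congr (_ `^ _); ring.
    have -> : expR (- p) = expR (- (p / 2 * (1 + s))) * expR (- (p / 2 * (1 - s))).
      by rewrite -expRD; congr expR; field.
    move: (_ `^ _) (expR _) (expR _) (posp _ _) (posp _ _) => A1 A2 A3 A4 A5.
    by ring.
  move=> E; have {}E := congr1 (fun y => (p / 2)%:E * y)%E E.
  rewrite !muleA -!EFinM mulfV ?gt_eqF// mul1e in E.
  rewrite -E muleC; congr (_ * _)%E; congr EFin.
  rewrite posp_gt0E// (powRM _ (ltW p0))// ?invr_ge0//.
  have -> : (2^-1 : R) `^ (2 * (x - 1)) = 2 `^ (2 - 2 * x).
    rewrite -powR_inv1// -powRrM; congr (_ `^ _); ring.
  have -> : 2 * x - 1 = 1 + 2 * (x - 1) by ring.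
  have -> : 2 - 2 * x = 1 + (1 - 2 * x) by ring.
  rewrite !(@powRD _ _ 1) ?(gt_eqF p0) ?implybT// ?pnatr_eq0 ?implybT//.
  by rewrite !powRr1 ?(ltW p0)//; field.
have := @fubini_tonelli _ _ (measurableTypeR R) (measurableTypeR R) R mu mu K mK K0.
under eq_integral do rewrite E1.
under [X in _ = X -> _]eq_integral do rewrite E2.
rewrite ge0_integralZl_EFin//; last 3 first.
- by move=> a _; rewrite lee_fin.
- exact/measurable_EFinP.
- by rewrite ltW// Gamma_gt0.
rewrite ge0_integralZl//; last 2 first.
- by apply/measurable_EFinP; meas.
- by move=> v _; rewrite lee_fin !mulr_ge0 ?posp_ge0 ?powR_ge0 ?expR_ge0.
under [X in (_ * X)%E = _ -> _]eq_integral do rewrite /f.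
under [X in _ = (_ * X)%E -> _]eq_integral do rewrite EFinM.
rewrite ge0_integralZl_EFin ?powR_ge0//; last 2 first.
- by move=> v _; rewrite lee_fin !mulr_ge0 ?posp_ge0 ?powR_ge0 ?expR_ge0.
- by apply/measurable_EFinP; meas.
by rewrite !GammaE// -!EFinM muleC.
Qed.

(** Multiply [Gamma_sqr] by Gamma(x + 1/2), use [Gamma_half], and cancel
    Gamma(x). *)
Lemma Gamma_duplication (x : R) : 0 < x ->
  Gamma x * Gamma (x + 2^-1) = 2 `^ (1 - 2 * x) * Num.sqrt pi * Gamma (2 * x).
Proof.
move=> x0.
have xh : 0 < Gamma (x + 2^-1) by rewrite Gamma_gt0// addr_gt0.
have E1 := Gamma_half x0.
have E2 := Gamma_sqr x0.
have : ((Gamma x ^+ 2 * Gamma (x + 2^-1))%:E = (2 `^ (1 - 2 * x) * Gamma (2 * x) * (Num.sqrt pi * Gamma x))%:E)%E.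
  rewrite EFinM E2 -muleA [(I x * _)%E]muleC E1 -EFinM//.
move=> [E]; apply: (mulfI (lt0r_neq0 (Gamma_gt0 x0))).
rewrite mulrA -expr2 E; move: (Gamma _) (Gamma _) (_ `^ _) (Num.sqrt _) => A1 A2 A3 A4.
by ring.
Qed.

End Gauss.

(** * Integration on products and on complex tuples *)

Section PushProd.
Context d1 d2 (T1 : measurableType d1) (T2 : measurableType d2) (R : realType).

Lemma integral_pushforward_iso (mu : {sigma_finite_measure set T1 -> \bar R})
    (f : T1 -> T2) (g : T2 -> T1) (mf : measurable_fun setT f)
    (mg : measurable_fun setT g) (fK : cancel f g) (h : T2 -> \bar R) :
  measurable_fun setT h -> (forall x, 0 <= h x)%E ->
  (\int[pushforward_iso mu mf mg fK]_x h x = \int[mu]_x h (f x))%E.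
Proof.
move=> mh h0.
have := @ge0_integral_pushforward _ _ T1 T2 R f mf mu setT h measurableT mh (fun x _ => h0 x).
by rewrite preimage_setT.
Qed.

Lemma integral_sfproduct (m1 : {sigma_finite_measure set T1 -> \bar R})
    (m2 : {sigma_finite_measure set T2 -> \bar R}) (h : T1 * T2 -> \bar R) :
  measurable_fun setT h -> (forall x, 0 <= h x)%E ->
  (\int[sfproduct m1 m2]_x h x = \int[m1]_x \int[m2]_y h (x, y))%E.
Proof. by move=> mh h0; exact: (@fubini_tonelli1 _ _ T1 T2 R m1 m2 h mh h0). Qed.

Lemma integral_sfproduct_swap (m1 : {sigma_finite_measure set T1 -> \bar R})
    (m2 : {sigma_finite_measure set T2 -> \bar R}) (h : T1 * T2 -> \bar R) :
  measurable_fun setT h -> (forall x, 0 <= h x)%E ->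
  (\int[sfproduct m1 m2]_x h x = \int[m2]_y \int[m1]_x h (x, y))%E.
Proof. by move=> mh h0; exact: (@fubini_tonelli2 _ _ T1 T2 R m1 m2 h mh h0). Qed.

Lemma measurable_integral_ge0 (m2 : {sigma_finite_measure set T2 -> \bar R})
    (h : T1 * T2 -> \bar R) :
  measurable_fun setT h -> (forall x, 0 <= h x)%E ->
  measurable_fun setT (fun x => \int[m2]_y h (x, y))%E.
Proof. by move=> mh h0; exact: (@measurable_fun_fubini_tonelli_F _ _ T1 T2 R m2 h mh h0). Qed.

End PushProd.

Section TupleInt.
Context d (T : measurableType d) (R : realType).
Variable m : {sigma_finite_measure set T -> \bar R}.

Lemma integral_tuple0 (h : 0.-tuple T -> \bar R) :
  measurable_fun setT h ->
  (\int[tuple_measure m 0]_x h x = h [tuple])%E.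
Proof.
move=> mh; rewrite /= integral_dirac// diracE.
by rewrite mem_set// mul1e.
Qed.

Lemma integral_tuple_cons n (h : n.+1.-tuple T -> \bar R) :
  measurable_fun setT h -> (forall x, 0 <= h x)%E ->
  (\int[tuple_measure m n.+1]_x h x =
   \int[m]_x \int[tuple_measure m n]_t h (tuple_cons (x, t)))%E.
Proof.
move=> mh h0; rewrite integral_pushforward_iso//.
rewrite (@integral_sfproduct _ _ _ _ _ _ _ (fun x => h (tuple_cons x)))//.
by apply: measurableT_comp => //; exact: measurable_tuple_cons.
Qed.

End TupleInt.

Section ComplexMeas.
Context (R : realType).
Local Notation C := R[i].
Notation mu := (@lebesgue_measure R).
Notation rT := (measurableTypeR R).

Lemma measurable_Re : measurable_fun [set: C] (@complex.Re R).
Proof.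
exact: (measurableT_comp (@measurable_fst _ _ _ _) (@measurable_pair_of_complex R)).
Qed.

Lemma measurable_Im : measurable_fun [set: C] (@complex.Im R).
Proof.
exact: (measurableT_comp (@measurable_snd _ _ _ _) (@measurable_pair_of_complex R)).
Qed.

Lemma measurable_Complex d (T : measurableType d) (f g : T -> R) :
  measurable_fun setT f -> measurable_fun setT g ->
  measurable_fun setT (fun x => Complex (f x) (g x)).
Proof.
move=> mf mg.
exact: (measurableT_comp (@measurable_complex_of_pair R) (measurable_fun_pair mf mg)).
Qed.

Lemma normc_sqr (z : C) : normc z ^+ 2 = complex.Re z ^+ 2 + complex.Im z ^+ 2.
Proof. by case: z => a b /=; rewrite sqr_sqrtr// addr_ge0 ?sqr_ge0. Qed.

Lemma normc_sqrt (z : C) : normc z = Num.sqrt (complex.Re z ^+ 2 + complex.Im z ^+ 2).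
Proof. by case: z. Qed.

Lemma normc_ge0 (z : C) : 0 <= normc z.
Proof. by rewrite normc_sqrt sqrtr_ge0. Qed.

Lemma integral_lebesgueC (f : C -> \bar R) :
  measurable_fun setT f -> (forall z, 0 <= f z)%E ->
  (\int[lebesgueC R]_z f z = \int[mu]_y \int[mu]_x f (Complex x y))%E.
Proof.
move=> mf f0; rewrite integral_pushforward_iso//.
rewrite (@integral_sfproduct_swap _ _ rT rT R mu mu (fun x => f (complex_of_pair x)))//.
by apply: measurableT_comp => //; exact: measurable_complex_of_pair.
Qed.

(** In the right-hand side [w.1] stands for the imaginary part: there it will be
    the height, which comes before the real part in the coordinates of the
    Siegel domain and is integrated after it. *)
Lemma integral_lebesgueC_affine_swap (f : C -> \bar R) (c b1 b2 : R) : 0 < c ->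
  measurable_fun setT f -> (forall z, 0 <= f z)%E ->
  (\int[lebesgueC R]_z f z =
   (c * c)%:E * \int[sfproduct mu mu]_w f (Complex (c * w.2 + b1)%R (c * w.1 + b2)%R))%E.
Proof.
move=> c0 mf f0.
have mfw (k1 k2 k3 k4 : R) : measurable_fun [set: R * R]
    (fun w : R * R => f (Complex (k1 * w.2 + k2) (k3 * w.1 + k4))).
  by apply: (measurableT_comp mf); apply: measurable_Complex; meas.
rewrite integral_lebesgueC//.
rewrite (@integral_sfproduct _ _ rT rT R mu mu (fun w => f (Complex (c * w.2 + b1) (c * w.1 + b2))))//=; last exact: mfw.
have E x : (\int[mu]_y f (Complex (c * y + b1)%R x) = c^-1%:E * \int[mu]_y f (Complex y x))%E.
  rewrite (@integral_affine R c b1 c0 (fun y => f (Complex y x)))//.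
  by apply: (measurableT_comp mf); apply: measurable_Complex; meas.
have mI : measurable_fun setT (fun y => \int[mu]_x f (Complex x y))%E.
  have := @measurable_integral_ge0 _ _ rT rT R mu _ (mfw 1 0 1 0) (fun=> f0 _).
  by apply: eq_measurable_fun => y _ /=; apply: eq_integral => x _; rewrite !mul1r !addr0.
under [X in _ = (_ * X)%E]eq_integral do rewrite E.
rewrite ge0_integralZl_EFin ?invr_ge0 ?(ltW c0)//; last 2 first.
- by move=> x _; apply: integral_ge0.
- by apply: (measurableT_comp mI); meas.
rewrite (@integral_affine R c b2 c0 (fun y => \int[mu]_x f (Complex x y))%E)//.
  by rewrite !muleA -!EFinM -mulrA mulrACA mulfV ?gt_eqF// mulr1 mul1e.
by move=> y; apply: integral_ge0.
Qed.

Lemma integral_lebesgueC_affine (f : C -> \bar R) (a : R) (b : C) : 0 < a ->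
  measurable_fun setT f -> (forall z, 0 <= f z)%E ->
  (\int[lebesgueC R]_z f z = (a ^+ 2)%:E * \int[lebesgueC R]_z f (b + a%:C%C * z)%R)%E.
Proof.
move=> a0 mf f0.
have E x y : b + a%:C%C * Complex x y = Complex (a * x + complex.Re b) (a * y + complex.Im b).
  case: b => b1 b2 /=; apply/eqP; rewrite eq_complex /=; apply/andP; split; apply/eqP; ring.
have mg : measurable_fun setT (fun z : C => f (b + a%:C%C * z)).
  have -> : (fun z : C => f (b + a%:C%C * z)) = (fun z : C => f (Complex (a * complex.Re z + complex.Re b) (a * complex.Im z + complex.Im b))).
    by apply/funext => -[x y]; rewrite E.
  apply: (measurableT_comp mf); apply: measurable_Complex.
    by apply: measurable_funD => //; apply: measurable_funM => //; exact: measurable_Re.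
  by apply: measurable_funD => //; apply: measurable_funM => //; exact: measurable_Im.
rewrite [in RHS](@integral_lebesgueC_affine_swap _ 1 0 0)// mul1r mul1e.
rewrite (@integral_lebesgueC_affine_swap f a (complex.Re b) (complex.Im b))// expr2.
by congr (_ * _)%E; apply: eq_integral => -[x y] _ /=; rewrite E !mul1r !addr0.
Qed.

Lemma measurable_normc : measurable_fun [set: C] (@normc R).
Proof.
have -> : @normc R = (fun z : C => (complex.Re z ^+ 2 + complex.Im z ^+ 2) `^ 2^-1).
  by apply/funext => z; rewrite normc_sqrt powR12_sqrt// addr_ge0 ?sqr_ge0.
have := measurable_Re; have := measurable_Im => mI mR; meas.
Qed.

Lemma measurable_affineC (b : C) (a : R) :
  measurable_fun setT (fun z : C => b + a%:C%C * z).
Proof.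
have -> : (fun z : C => b + a%:C%C * z) =
    (fun z : C => Complex (a * complex.Re z + complex.Re b) (a * complex.Im z + complex.Im b)).
  apply/funext => -[x y]; case: b => b1 b2 /=.
  by apply/eqP; rewrite eq_complex /=; apply/andP; split; apply/eqP; ring.
have := measurable_Re; have := measurable_Im => mI mR.
by apply: measurable_Complex; meas.
Qed.

Lemma integral_gaussC (v : R) : 0 < v ->
  (\int[lebesgueC R]_z (expR (- (v * normc z ^+ 2)))%:E = (pi * v^-1)%:E)%E.
Proof.
move=> v0.
have mE : measurable_fun setT (fun z : C => (expR (- (v * normc z ^+ 2)))%:E).
  by apply/measurable_EFinP; have := measurable_normc => mn; meas.
rewrite integral_lebesgueC//.
have E (y : R) : (\int[mu]_x (expR (- (v * normc (Complex x y) ^+ 2)))%:E =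
    (Num.sqrt pi * v `^ (- 2^-1))%:E * (expR (- (v * y ^+ 2)))%:E)%E.
  transitivity (\int[mu]_x ((expR (- (v * y ^+ 2)))%:E * (expR (- (v * x ^+ 2)))%:E))%E.
    apply: eq_integral => x _; rewrite -EFinM -expRD normc_sqr/=; congr (expR _)%:E.
    by ring.
  rewrite ge0_integralZl_EFin ?expR_ge0//; last by apply/measurable_EFinP; meas.
  by rewrite integral_gauss_scale// muleC.
under eq_integral do rewrite E.
rewrite ge0_integralZl_EFin//; last 2 first.
- by apply/measurable_EFinP; meas.
- by rewrite mulr_ge0 ?sqrtr_ge0 ?powR_ge0.
rewrite integral_gauss_scale// -EFinM; congr EFin.
rewrite mulrACA -expr2 sqr_sqrtr ?pi_ge0//; congr (_ * _).
rewrite powRN powR12_sqrt ?(ltW v0)//.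
by rewrite -invfM -expr2 sqr_sqrtr// ltW.
Qed.

End ComplexMeas.

Section ComplexTuple.
Context (R : realType).
Local Notation C := R[i].
Local Notation lambda n := (tuple_measure (lebesgueC R) n).

Definition normsq n (t : n.-tuple C) : R := \sum_(j < n) normc (tnth t j) ^+ 2.

Lemma normsq_ge0 n (t : n.-tuple C) : 0 <= normsq t.
Proof. by apply: sumr_ge0 => j _; exact: sqr_ge0. Qed.

Lemma measurable_normsq n : measurable_fun setT (@normsq n).
Proof.
apply: measurable_sum => j; apply: measurable_funX.
by apply: (measurableT_comp (@measurable_normc R)); exact: measurable_tnth.
Qed.

Lemma normsq_cons n (x : C * n.-tuple C) :
  normsq (tuple_cons x) = normc x.1 ^+ 2 + normsq x.2.
Proof.
rewrite /normsq big_ord_recl; congr (_ + _).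
by apply: eq_bigr => j _; rewrite tnthS.
Qed.

(** The Gaussian factorises over the coordinates, so that each complex
    coordinate contributes a factor pi / v. *)
Lemma integral_gauss_tuple n (v : R) : 0 < v ->
  (\int[lambda n]_t (expR (- (v * normsq t)))%:E = (pi ^+ n * v `^ (- n%:R))%:E)%E.
Proof.
move=> v0.
have mE k : measurable_fun setT (fun t : k.-tuple C => (expR (- (v * normsq t)))%:E).
  by apply/measurable_EFinP; have := @measurable_normsq k => mn; meas.
elim: n => [|n IH].
  rewrite integral_tuple0// /normsq big_ord0 mulr0 oppr0 expR0 expr0.
  by rewrite powRr0 mulr1.
rewrite integral_tuple_cons//.
have E (x : C) : (\int[lambda n]_t (expR (- (v * normsq (tuple_cons (x, t)))))%:E =
    (pi ^+ n * v `^ (- n%:R))%:E * (expR (- (v * normc x ^+ 2)))%:E)%E.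
  rewrite -IH muleC -ge0_integralZl_EFin ?expR_ge0//; last exact: mE.
  apply: eq_integral => t _; rewrite normsq_cons -EFinM -expRD /=; congr (expR _)%:E.
  by ring.
under eq_integral do rewrite E.
rewrite ge0_integralZl_EFin//; last 2 first.
- by apply/measurable_EFinP; have := @measurable_normc R => mn; meas.
- by rewrite mulr_ge0 ?exprn_ge0 ?pi_ge0 ?powR_ge0.
rewrite integral_gaussC// -EFinM; congr EFin.
rewrite mulrACA -exprSr -[v^-1]powR_inv1 ?(ltW v0)// -powRD ?(gt_eqF v0) ?implybT//.
by rewrite -opprD natr1.
Qed.

Definition tuple_affine n (b : n.-tuple C) (a : R) (t : n.-tuple C) : n.-tuple C :=
  [tuple tnth b j + a%:C%C * tnth t j | j < n].

Lemma measurable_tuple_affine n (b : n.-tuple C) (a : R) :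
  measurable_fun setT (tuple_affine b a).
Proof.
apply/measurable_fun_tnthP => j.
have -> : (tnth (T:=C))^~ j \o tuple_affine b a = (fun t => tnth b j + a%:C%C * tnth t j).
  by apply/funext => t /=; rewrite tnth_mktuple.
exact: (measurableT_comp (measurable_affineC (tnth b j) a) (@measurable_tnth _ _ _ j)).
Qed.

Lemma integral_tuple_affine n (f : n.-tuple C -> \bar R) (b : n.-tuple C) (a : R) :
  0 < a -> measurable_fun setT f -> (forall t, 0 <= f t)%E ->
  (\int[lambda n]_t f t = ((a ^+ 2) ^+ n)%:E * \int[lambda n]_t f (tuple_affine b a t))%E.
Proof.
move=> a0; elim: n f b => [|n IH] f b mf f0.
  have mf' : measurable_fun setT (fun t => f (tuple_affine b a t)).
    by apply: (measurableT_comp mf); exact: measurable_tuple_affine.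
  by rewrite !integral_tuple0// expr0 mul1e; congr f; exact/esym/tuple0.
have mfb : measurable_fun setT (fun t => f (tuple_affine b a t)).
  by apply: (measurableT_comp mf); exact: measurable_tuple_affine.
have mfc : measurable_fun setT (fun x => f (tuple_cons x)).
  by apply: (measurableT_comp mf); exact: measurable_tuple_cons.
rewrite !integral_tuple_cons//.
pose b' := [tuple tnth b (lift ord0 j) | j < n].
have E x t : tuple_affine b a (tuple_cons (x, t)) =
    tuple_cons (tnth b ord0 + a%:C%C * x, tuple_affine b' a t).
  apply: eq_from_tnth => j; rewrite tnth_mktuple.
  case: (unliftP ord0 j) => [i ->|->]; last by [].
  by rewrite !tnthS tnth_mktuple tnth_mktuple.
have mx x : measurable_fun setT (fun t => f (tuple_cons (x, t))).
  by apply: (measurableT_comp mfc); exact: pair1_measurable.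
rewrite (@integral_lebesgueC_affine _ _ a (tnth b ord0) a0); last 2 first.
- exact: (@measurable_integral_ge0 _ _ _ _ _ (lambda n) _ mfc).
- by move=> x; apply: integral_ge0.
have E2 x : (\int[lambda n]_t f (tuple_cons (tnth b ord0 + a%:C%C * x, t)%R) =
   ((a ^+ 2) ^+ n)%:E * \int[lambda n]_t f (tuple_affine b a (tuple_cons (x, t))))%E.
  by rewrite (IH _ b')//; congr (_ * _)%E; apply: eq_integral => t _; rewrite E.
under eq_integral do rewrite E2.
rewrite ge0_integralZl_EFin//; last 3 first.
- by move=> x _; apply: integral_ge0.
- have mfbc : measurable_fun setT (fun x => f (tuple_affine b a (tuple_cons x))).
    by apply: (measurableT_comp mfb); exact: measurable_tuple_cons.
  exact: (@measurable_integral_ge0 _ _ _ _ _ (lambda n) _ mfbc).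
- by rewrite exprn_ge0// sqr_ge0.
by rewrite muleA -EFinM -exprS.
Qed.

End ComplexTuple.

(** * The group acting on the Siegel domain *)

Section SiegelCoord.
Context (R : realType) (n : nat).
Local Notation C := R[i].
Local Notation Cn1 := (n.-tuple C * C)%type.
Local Notation rT := (measurableTypeR R).
Local Notation W := (n.-tuple C * (rT * rT))%type.
Notation mu := (@lebesgue_measure R).
Local Notation lambda n := (tuple_measure (lebesgueC R) n).
Implicit Types z : Cn1.

Definition height z : R := complex.Im z.2 - normsq z.1.

(** The kernel only involves rho through its modulus, so that the Hermitian
    product is used through its real and imaginary parts. *)
Definition hermRe (x y : n.-tuple C) : R :=
  \sum_(j < n) complex.Re (tnth x j * conjc (tnth y j)).
Definition hermIm (x y : n.-tuple C) : R :=
  \sum_(j < n) complex.Im (tnth x j * conjc (tnth y j)).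

Lemma ReB (x y : C) : complex.Re (x - y) = complex.Re x - complex.Re y.
Proof. by case: x y => [? ?] [? ?]. Qed.
Lemma ImB (x y : C) : complex.Im (x - y) = complex.Im x - complex.Im y.
Proof. by case: x y => [? ?] [? ?]. Qed.

Lemma Re_sum I (r : seq I) (F : I -> C) :
  complex.Re (\sum_(i <- r) F i) = \sum_(i <- r) complex.Re (F i).
Proof. by apply: (big_morph _ _ (erefl _)) => -[? ?] [? ?]. Qed.
Lemma Im_sum I (r : seq I) (F : I -> C) :
  complex.Im (\sum_(i <- r) F i) = \sum_(i <- r) complex.Im (F i).
Proof. by apply: (big_morph _ _ (erefl _)) => -[? ?] [? ?]. Qed.

Lemma half_i (x : C) : 'i%C / 2%:R * x = Complex (- complex.Im x / 2) (complex.Re x / 2).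
Proof.
have -> : 'i%C / 2%:R = Complex 0 (2^-1) :> C.
  apply: (@mulIf _ 2%:R); first by rewrite pnatr_eq0.
  rewrite mulfVK ?pnatr_eq0// mulr_natr mulr2n.
  by apply/eqP; rewrite eq_complex /=; apply/andP; split; apply/eqP; field.
by case: x => a b; apply/eqP; rewrite eq_complex /=; apply/andP; split; apply/eqP; field.
Qed.

Lemma Re_rho z (w : Cn1) :
  complex.Re (rho z w) = (complex.Im w.2 + complex.Im z.2) / 2 - hermRe z.1 w.1.
Proof.
rewrite /rho half_i ReB Re_sum ImB; congr (_ - _).
by case: (w.2) => a b /=; congr (_ / _); ring.
Qed.

Lemma Im_rho z (w : Cn1) :
  complex.Im (rho z w) = (complex.Re w.2 - complex.Re z.2) / 2 - hermIm z.1 w.1.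
Proof.
rewrite /rho half_i ImB Im_sum; congr (_ - _).
by case: (w.2) (z.2) => a b [c d].
Qed.

Lemma hermRe_sym x y : hermRe x y = hermRe y x.
Proof.
by apply: eq_bigr => j _; case: (tnth x j) (tnth y j) => [a b] [c d] /=; ring.
Qed.

Lemma hermIm_sym x y : hermIm x y = - hermIm y x.
Proof.
rewrite /hermIm -sumrN.
by apply: eq_bigr => j _; case: (tnth x j) (tnth y j) => [a b] [c d] /=; ring.
Qed.

Lemma normc_rho_sym z (w : Cn1) : normc (rho z w) = normc (rho w z).
Proof.
rewrite !normc_sqrt !Re_rho !Im_rho hermRe_sym (hermIm_sym z.1).
by congr Num.sqrt; field.
Qed.

Lemma siegelE z : siegel z <-> 0 < height z.
Proof. by rewrite /siegel/= /height subr_gt0. Qed.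

Lemma Re_rho_diag z : complex.Re (rho z z) = height z.
Proof. by rewrite rho_diag. Qed.

Lemma hermRe_affine x y a : hermRe x (tuple_affine x a y) = normsq x + a * hermRe x y.
Proof.
rewrite /hermRe /normsq mulr_sumr -big_split/=; apply: eq_bigr => j _.
rewrite tnth_mktuple normc_sqr.
by case: (tnth x j) (tnth y j) => [p q] [c d] /=; ring.
Qed.

Lemma hermIm_affine x y a : hermIm x (tuple_affine x a y) = a * hermIm x y.
Proof.
rewrite /hermIm mulr_sumr; apply: eq_bigr => j _; rewrite tnth_mktuple.
by case: (tnth x j) (tnth y j) => [p q] [c d] /=; ring.
Qed.

Lemma normsq_affine x y a :
  normsq (tuple_affine x a y) = normsq x + 2 * a * hermRe x y + a ^+ 2 * normsq y.
Proof.
rewrite /normsq /hermRe !mulr_sumr -!big_split/=; apply: eq_bigr => j _.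
rewrite tnth_mktuple !normc_sqr.
by case: (tnth x j) (tnth y j) => [p q] [c d] /=; ring.
Qed.

(** With w = (eta, (s, tau)), this is the point that has coordinates eta, s and
    tau relative to z: the dilation by height(z) acts with weight 1/2 on eta and
    1 on (s, tau), then comes the Heisenberg translation by
    (z', Re z_{n+1}).  The term in [hermIm] is the twist of the Heisenberg
    product, and [normsq x] converts heights into imaginary parts. *)
Definition transport z (w : W) : Cn1 :=
  let a := Num.sqrt (height z) in
  let x := tuple_affine z.1 a w.1 in
  (x, Complex (height z * w.2.2 + (complex.Re z.2 + 2 * a * hermIm z.1 w.1))
              (height z * w.2.1 + normsq x)).

Lemma height_transport z w : height (transport z w) = height z * w.2.1.
Proof. by rewrite /transport /height/= addrK. Qed.

(** The twist in [transport] cancels the imaginary part of the Hermitian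
    product, so that only the factor height(z) depends on z. *)
Lemma rho_transport z w : 0 < height z ->
  normc (rho z (transport z w)) =
  height z / 2 * Num.sqrt ((1 + w.2.1 + normsq w.1) ^+ 2 + w.2.2 ^+ 2).
Proof.
move=> hz; rewrite normc_sqrt Re_rho Im_rho /= hermRe_affine hermIm_affine normsq_affine.
rewrite sqr_sqrtr ?(ltW hz)//.
have -> : complex.Im z.2 = height z + normsq z.1 by rewrite /height subrK.
have hz2 : 0 <= height z / 2 by rewrite divr_ge0// ltW.
rewrite -[height z / 2](ger0_norm hz2) -sqrtr_sqr -sqrtrM ?sqr_ge0//.
by congr Num.sqrt; field.
Qed.

Lemma measurable_hermRe : measurable_fun setT
  (fun p : n.-tuple C * n.-tuple C => hermRe p.1 p.2).
Proof.
apply: measurable_sum => j.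
have -> : (fun p : n.-tuple C * n.-tuple C => complex.Re (tnth p.1 j * conjc (tnth p.2 j))) =
  (fun p => complex.Re (tnth p.1 j) * complex.Re (tnth p.2 j) +
            complex.Im (tnth p.1 j) * complex.Im (tnth p.2 j)).
  by apply/funext => -[x y] /=; case: (tnth x j) (tnth y j) => [p q] [c d] /=; ring.
have m1 : measurable_fun setT (fun p : n.-tuple C * n.-tuple C => tnth p.1 j).
  exact: (measurableT_comp (@measurable_tnth _ _ _ j)).
have m2 : measurable_fun setT (fun p : n.-tuple C * n.-tuple C => tnth p.2 j).
  exact: (measurableT_comp (@measurable_tnth _ _ _ j)).
by apply: measurable_funD; apply: measurable_funM;
  do ?[exact: (measurableT_comp (@measurable_Re R))|exact: (measurableT_comp (@measurable_Im R))].
Qed.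

Lemma measurable_hermIm : measurable_fun setT
  (fun p : n.-tuple C * n.-tuple C => hermIm p.1 p.2).
Proof.
apply: measurable_sum => j.
have -> : (fun p : n.-tuple C * n.-tuple C => complex.Im (tnth p.1 j * conjc (tnth p.2 j))) =
  (fun p => complex.Im (tnth p.1 j) * complex.Re (tnth p.2 j) -
            complex.Re (tnth p.1 j) * complex.Im (tnth p.2 j)).
  by apply/funext => -[x y] /=; case: (tnth x j) (tnth y j) => [p q] [c d] /=; ring.
have m1 : measurable_fun setT (fun p : n.-tuple C * n.-tuple C => tnth p.1 j).
  exact: (measurableT_comp (@measurable_tnth _ _ _ j)).
have m2 : measurable_fun setT (fun p : n.-tuple C * n.-tuple C => tnth p.2 j).
  exact: (measurableT_comp (@measurable_tnth _ _ _ j)).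
by apply: measurable_funB; apply: measurable_funM;
  do ?[exact: (measurableT_comp (@measurable_Re R))|exact: (measurableT_comp (@measurable_Im R))].
Qed.

Lemma measurable_height : measurable_fun setT height.
Proof.
apply: measurable_funB.
  by apply: (measurableT_comp (@measurable_Im R)); exact: measurable_snd.
by apply: (measurableT_comp (@measurable_normsq R n)); exact: measurable_fst.
Qed.

Lemma measurable_siegel : measurable (@siegel R n).
Proof.
have -> : @siegel R n = height @^-1` `]0, +oo[%classic.
  by apply/seteqP; split => z; rewrite siegelE /= in_itv/= andbT.
by rewrite -[X in measurable X]setTI; exact: measurable_height.
Qed.

Lemma measurable_normc_rho : measurable_fun setT (fun p : Cn1 * Cn1 => normc (rho p.1 p.2)).
Proof.
have -> : (fun p : Cn1 * Cn1 => normc (rho p.1 p.2)) =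
  (fun p => (((complex.Im p.2.2 + complex.Im p.1.2) / 2 - hermRe p.1.1 p.2.1) ^+ 2 +
   ((complex.Re p.2.2 - complex.Re p.1.2) / 2 - hermIm p.1.1 p.2.1) ^+ 2) `^ 2^-1).
  by apply/funext => p; rewrite powR12_sqrt ?addr_ge0 ?sqr_ge0// normc_sqrt Re_rho Im_rho.
have m11 : measurable_fun setT (fun p : Cn1 * Cn1 => (p.1.1, p.2.1)).
  by apply: measurable_fun_pair; exact: (measurableT_comp (@measurable_fst _ _ _ _)).
have m12 : measurable_fun setT (fun p : Cn1 * Cn1 => p.1.2).
  exact: (measurableT_comp (@measurable_snd _ _ _ _)).
have m22 : measurable_fun setT (fun p : Cn1 * Cn1 => p.2.2).
  exact: (measurableT_comp (@measurable_snd _ _ _ _)).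
have mR2 := measurableT_comp (@measurable_Re R) m22.
have mR1 := measurableT_comp (@measurable_Re R) m12.
have mI2 := measurableT_comp (@measurable_Im R) m22.
have mI1 := measurableT_comp (@measurable_Im R) m12.
have mhR := measurableT_comp measurable_hermRe m11.
have mhI := measurableT_comp measurable_hermIm m11.
by meas.
Qed.

Lemma measurable_transport z : measurable_fun setT (transport z).
Proof.
have mx : measurable_fun setT (fun w : W => tuple_affine z.1 (Num.sqrt (height z)) w.1).
  by apply: (measurableT_comp (@measurable_tuple_affine R n z.1 _)); exact: measurable_fst.
apply: measurable_fun_pair => //.
have mh : measurable_fun setT (fun w : W => hermIm z.1 w.1).
  have := measurableT_comp measurable_hermIm (@pair1_measurable _ _ _ (n.-tuple C) z.1).
  by move=> h; apply: (measurableT_comp h); exact: measurable_fst.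
have mn := measurableT_comp (@measurable_normsq R n) mx.
have m1 : measurable_fun setT (fun w : W => w.2.1 : R).
  exact: (measurableT_comp (@measurable_fst _ _ _ _)).
have m2 : measurable_fun setT (fun w : W => w.2.2 : R).
  exact: (measurableT_comp (@measurable_snd _ _ _ _)).
by apply: measurable_Complex; meas.
Qed.

Definition dW : {sigma_finite_measure set W -> \bar R} :=
  sfproduct (lambda n) (sfproduct mu mu).

(** The map is triangular: eta is scaled by the square root of height(z) in 2n
    real directions, s and tau are scaled by height(z), and the remaining terms
    are translations once eta is fixed.  The Jacobian is thus
    height(z)^n height(z)^2. *)
Lemma integral_transport z (F : Cn1 -> \bar R) : 0 < height z ->
  measurable_fun setT F -> (forall w, 0 <= F w)%E ->
  (\int[dV R n]_w F w = (height z ^+ n.+2)%:E * \int[dW]_w F (transport z w))%E.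
Proof.
move=> hz mF F0.
have a0 : 0 < Num.sqrt (height z) by rewrite sqrtr_gt0.
have mFt : measurable_fun setT (fun w => F (transport z w)).
  by apply: (measurableT_comp mF); exact: measurable_transport.
rewrite /dV /dW !integral_sfproduct//.
rewrite (@integral_tuple_affine R n _ z.1 _ a0); last 2 first.
- exact: (@measurable_integral_ge0 _ _ _ _ _ (lebesgueC R) _ mF).
- by move=> t; apply: integral_ge0.
rewrite sqr_sqrtr ?(ltW hz)// (_ : height z ^+ n.+2 = height z ^+ n * (height z * height z)); last first.
  by rewrite !exprSr mulrA.
rewrite [in RHS]EFinM -[in RHS]muleA; congr (_ * _)%E.
rewrite -ge0_integralZl_EFin; last 4 first.
- by [].
- by move=> t _; apply: integral_ge0.
- exact: (@measurable_integral_ge0 _ _ _ _ _ (sfproduct mu mu) _ mFt).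
- by rewrite mulr_ge0// ltW.
apply: eq_integral => t _.
set x := tuple_affine _ _ t.
rewrite (@integral_lebesgueC_affine_swap R _ (height z) (complex.Re z.2 + 2 * Num.sqrt (height z) * hermIm z.1 t) (normsq x))//.
by apply: (measurableT_comp mF); exact: pair1_measurable.
Qed.

Variable alpha : R.
Local Notation N := (n%:R + 2 + alpha).

(** The kernel seen from the base point.  The factor [posp alpha w.2.1] vanishes
    for s <= 0, that is, outside the domain. *)
Definition kernel0 (w : W) : R :=
  posp alpha w.2.1 * (2 `^ N * ((1 + w.2.1 + normsq w.1) ^+ 2 + w.2.2 ^+ 2) `^ (- (N / 2))).

Lemma kernel0_ge0 w : 0 <= kernel0 w.
Proof. by rewrite !mulr_ge0 ?posp_ge0 ?powR_ge0. Qed.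

Lemma measurable_kernel0 : measurable_fun setT kernel0.
Proof.
have m1 : measurable_fun setT (fun w : W => w.2.1 : R).
  exact: (measurableT_comp (@measurable_fst _ _ _ _)).
have m2 : measurable_fun setT (fun w : W => w.2.2 : R).
  exact: (measurableT_comp (@measurable_snd _ _ _ _)).
have m3 : measurable_fun setT (fun w : W => normsq w.1).
  exact: (measurableT_comp (@measurable_normsq R n)).
by rewrite /kernel0; meas.
Qed.

Lemma T_kernel_transport z (w : W) : 0 < height z -> 0 < w.2.1 ->
  T_kernel alpha z (transport z w) = (height z ^+ n.+2)^-1 * kernel0 w.
Proof.
move=> hz s0; rewrite /T_kernel Re_rho_diag height_transport rho_transport//.
rewrite /kernel0 posp_gt0E// powRN.
set A := _ + w.2.2 ^+ 2; have A0 : 0 < A.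
  rewrite ltr_pwDl ?sqr_ge0// exprn_gt0// ltr_pwDl ?normsq_ge0// addr_gt0//.
set r := height z.
rewrite (powRM alpha (ltW hz) (ltW s0)).
rewrite (powRM N (_ : 0 <= r / 2)) ?sqrtr_ge0//; last by rewrite divr_ge0// ltW.
rewrite (powRM N (ltW hz))// -(powR12_sqrt (ltW A0)) -powRrM.
rewrite (_ : 2^-1 * N = N / 2); last by rewrite mulrC.
have -> : (2^-1 : R) `^ N = (2 `^ N)^-1.
  by rewrite -powRN -[X in X `^ _](@powR_inv1 _ 2)// -powRrM mulN1r.
have -> : r ^+ n.+2 = r `^ (n.+2)%:R by rewrite powR_mulrn// ltW.
have -> : r `^ N = r `^ n.+2%:R * r `^ alpha.
  rewrite -powRD ?(gt_eqF hz) ?implybT// (_ : N = n.+2%:R + alpha)//.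
  by rewrite -[n.+2]addn2 natrD.
have p1 : 0 < r `^ alpha by exact: powR_gt0.
have p2 : 0 < r `^ n.+2%:R by exact: powR_gt0.
have p3 : 0 < (2 : R) `^ N by exact: powR_gt0.
have p4 : 0 < A `^ (N / 2) by exact: powR_gt0.
move: (r `^ alpha) (r `^ n.+2%:R) (2 `^ N) (A `^ (N / 2)) (_ `^ alpha) p1 p2 p3 p4.
move=> a1 a2 a3 a4 a5 ? ? ? ?; field.
by rewrite !gt_eqF.
Qed.

Lemma measurable_T_kernel : measurable_fun setT (fun p : Cn1 * Cn1 => T_kernel alpha p.1 p.2).
Proof.
have m1 : measurable_fun setT (fun p : Cn1 * Cn1 => complex.Re (rho p.2 p.2)).
  have -> : (fun p : Cn1 * Cn1 => complex.Re (rho p.2 p.2)) = (fun p => height p.2).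
    by apply/funext => p; rewrite Re_rho_diag.
  by apply: (measurableT_comp measurable_height); exact: measurable_snd.
rewrite /T_kernel.
have -> : (fun p : Cn1 * Cn1 => complex.Re (rho p.2 p.2) `^ alpha / normc (rho p.1 p.2) `^ N) =
  (fun p : Cn1 * Cn1 => complex.Re (rho p.2 p.2) `^ alpha * normc (rho p.1 p.2) `^ (- N)).
  by apply/funext => p; rewrite powRN.
by have := measurable_normc_rho => m2; meas.
Qed.

Lemma T_kernel_ge0 z (w : Cn1) : 0 <= T_kernel alpha z w.
Proof. by rewrite /T_kernel divr_ge0 ?powR_ge0. Qed.

(** The Jacobian height(z)^(n+2) cancels the homogeneity of the kernel: this is
    the form of the operator as a convolution on the group. *)
Lemma integral_T_kernel z (F : Cn1 -> R) : 0 < height z ->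
  measurable_fun setT F -> (forall w, 0 <= F w) ->
  (\int[dV R n]_(w in @siegel R n) (T_kernel alpha z w * F w)%:E =
   \int[dW]_w (kernel0 w * F (transport z w))%:E)%E.
Proof.
move=> hz mF F0.
have mT : measurable_fun setT (fun w => T_kernel alpha z w).
  exact: (measurableT_comp measurable_T_kernel (@pair1_measurable _ _ _ _ z)).
rewrite integral_mkcond (integral_transport hz); last 2 first.
- apply: (measurable_restrictT _ _).1; first exact: measurable_siegel.
  by apply: measurable_funTS; apply/measurable_EFinP; exact: measurable_funM.
- by move=> w; apply: erestrict_ge0 => v _; rewrite lee_fin mulr_ge0// T_kernel_ge0.
have h0 : 0 < height z ^+ n.+2 by rewrite exprn_gt0.
rewrite -ge0_integralZl_EFin; last 4 first.
- by [].
- by move=> w _; apply: erestrict_ge0 => v _; rewrite lee_fin mulr_ge0// T_kernel_ge0.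
- apply: (measurableT_comp _ (measurable_transport z)).
  apply: (measurable_restrictT _ _).1; first exact: measurable_siegel.
  by apply: measurable_funTS; apply/measurable_EFinP; exact: measurable_funM.
- exact: ltW.
apply: eq_integral => w _; rewrite patchE.
have [s0|s0] := ltP 0 (w.2.1 : R).
  rewrite mem_set; last by rewrite siegelE height_transport mulr_gt0.
  rewrite T_kernel_transport// -EFinM; congr EFin.
  by rewrite -[X in _ * X = _]mulrA mulVKf ?gt_eqF.
rewrite memNset; last first.
  by rewrite siegelE height_transport pmulr_rgt0// ltNge s0.
by rewrite mule0 /kernel0 posp_le0E// !mul0r.
Qed.

Definition kernel_const (b : R) : R :=
  4 * pi ^+ n.+1 * Gamma (1 + alpha - b) * Gamma b / Gamma (N / 2) ^+ 2.

(** Three applications of [integral_laplace]: the Laplace transforms along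
    tau^2, s and |eta|^2 are powers by the Gauss, Gamma and n-dimensional Gauss
    integrals.  The factors Gamma(n + b) cancel, and the quotient of
    Gamma((N - 1)/2) by Gamma(N - 1) is evaluated by duplication. *)
Lemma integral_kernel0 b : -1 < alpha -> 0 < b -> b < 1 + alpha ->
  (\int[dW]_w (kernel0 w * posp (- b) w.2.1)%:E = (kernel_const b)%:E)%E.
Proof.
move=> alpha1 b0 ba.
(* The powers of 2 from the kernel and from duplication leave the factor 4. *)
have four : (4 : R) = 2 `^ N * 2 `^ (1 - (N - 1)).
  have E2 : N + (1 - (N - 1)) = 2%:R by ring.
  by rewrite -powRD ?pnatr_eq0 ?implybT// E2 powR_mulrn// expr2; ring.
have m1 : measurable_fun setT (fun w : W => w.2.1 : R).
  exact: (measurableT_comp (@measurable_fst _ _ _ _)).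
have mI : measurable_fun setT (fun w : W => (kernel0 w * posp (- b) w.2.1)%:E).
  by apply/measurable_EFinP; have := measurable_kernel0 => mk; meas.
have I0 w : (0 <= (kernel0 w * posp (- b) w.2.1)%:E)%E.
  by rewrite lee_fin mulr_ge0 ?posp_ge0 ?kernel0_ge0.
have N2 : 0 < N / 2.
  have n0 : 0 <= n%:R :> R by [].
  by rewrite divr_gt0//; lra.
have N1 : 1 < N by have n0 : 0 <= n%:R :> R by []; lra.
pose k1 := Num.sqrt pi * (Gamma (N / 2 - 2^-1) / Gamma (N / 2)).
have step1 (A : R) : 0 < A ->
  (\int[mu]_t ((A ^+ 2 + t ^+ 2) `^ (- (N / 2)))%:E = (k1 * A `^ (1 - N))%:E)%E.
  move=> A0.
  have A20 : 0 < A ^+ 2 by rewrite exprn_gt0.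
  have H v : 0 < v -> (\int[mu]_t (1 * expR (- (v * t ^+ 2)))%:E = (Num.sqrt pi * v `^ (- 2^-1))%:E)%E.
    move=> v0; rewrite -integral_gauss_scale//; apply: eq_integral => t _.
    by rewrite mul1r.
  have e2 : 2^-1 < N / 2 by rewrite -[ltLHS]mul1r ltr_pM2r.
  have := @integral_laplace _ rT R mu (fun=> 1) (fun t => t ^+ 2) _ _
    (@measurable_cst _ _ _ _ _ _) _ (fun=> ler01) (fun t => sqr_ge0 t) H _ _ A20 N2 e2.
  move=> L; transitivity (\int[mu]_t (1 * (A ^+ 2 + t ^+ 2) `^ (- (N / 2)))%:E)%E.
    by apply: eq_integral => t _; rewrite mul1r.
  rewrite L; last by meas.
  have E1 : 2%:R * (2^-1 - N / 2) = 1 - N by field.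
  by rewrite -powR_mulrn ?(ltW A0)// -powRrM E1.
pose k2 := Gamma (1 + alpha - b) * (Gamma (n%:R + b) / Gamma (N - 1)).
have step2 (B : R) : 0 < B ->
  (\int[mu]_s (posp (alpha - b) s * (B + posp 1 s) `^ (- (N - 1)))%:E = (k2 * B `^ (- (n%:R + b)))%:E)%E.
  move=> B0.
  have g1 : 0 < 1 + alpha - b by lra.
  have H v : 0 < v -> (\int[mu]_t (posp (alpha - b) t * expR (- (v * posp 1 t)))%:E =
     (Gamma (1 + alpha - b) * v `^ (- (1 + alpha - b)))%:E)%E.
    move=> v0; rewrite -(integral_gamma_scale g1 v0); apply: eq_integral => t _.
    rewrite (_ : 1 + alpha - b - 1 = alpha - b); last by ring.
    have [t0|t0] := ltP 0 t; last by rewrite posp_le0E// !mul0r.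
    by rewrite (posp_gt0E 1)// powRr1// ltW.
  have n0 : 0 <= n%:R :> R by [].
  have q0 : 0 < N - 1 by lra.
  have e2 : 1 + alpha - b < N - 1 by lra.
  have := @integral_laplace _ rT R mu (posp (alpha - b)) (posp 1) _ _
    (@measurable_posp _ _) (@measurable_posp _ _) (posp_ge0 _) (posp_ge0 _) H _ _ B0 q0 e2.
  have E1 : N - 1 - (1 + alpha - b) = n%:R + b by ring.
  have E3 : 1 + alpha - b - (N - 1) = - (n%:R + b) by ring.
  by move=> ->; rewrite E1 E3.
pose k3 := pi ^+ n * (Gamma b / Gamma (n%:R + b)).
have step3 : (\int[lambda n]_t ((1 + normsq t) `^ (- (n%:R + b)))%:E = k3%:E)%E.
  have H v : 0 < v -> (\int[lambda n]_t (1 * expR (- (v * normsq t)))%:E = (pi ^+ n * v `^ (- n%:R))%:E)%E.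
    move=> v0; rewrite -integral_gauss_tuple//; apply: eq_integral => t _.
    by rewrite mul1r.
  have q0 : 0 < n%:R + b by rewrite ltr_wpDl.
  have e2 : n%:R < n%:R + b by rewrite ltrDl.
  have := @integral_laplace _ _ R (lambda n) (fun=> 1) (@normsq R n) _ _
    (@measurable_cst _ _ _ _ _ _) (@measurable_normsq R n) (fun=> ler01) (@normsq_ge0 R n) H _ _ ltr01 q0 e2.
  move=> L; transitivity (\int[lambda n]_t (1 * (1 + normsq t) `^ (- (n%:R + b)))%:E)%E.
    by apply: eq_integral => t _; rewrite mul1r.
  have E1 : n%:R + b - n%:R = b by ring.
  by rewrite L powR1 mulr1 E1.
have k10 : 0 <= k1.
  rewrite mulr_ge0 ?sqrtr_ge0// divr_ge0// ltW// Gamma_gt0//; lra.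
have k20 : 0 <= k2.
  rewrite mulr_ge0 ?divr_ge0// ltW// Gamma_gt0//; have n0 : 0 <= n%:R :> R by []; lra.
rewrite /dW integral_sfproduct//.
transitivity (\int[lambda n]_t ((2 `^ N * k1 * k2)%:E * ((1 + normsq t) `^ (- (n%:R + b)))%:E))%E; last first.
  rewrite ge0_integralZl_EFin; last 4 first.
  - by [].
  - by move=> t _; rewrite lee_fin powR_ge0.
  - by apply/measurable_EFinP; have := @measurable_normsq R n => mn; meas.
  - exact: mulr_ge0 (mulr_ge0 (powR_ge0 _ _) k10) k20.
  rewrite step3 -EFinM; congr EFin.
  have q0 : 0 < n%:R + b by rewrite ltr_wpDl.
  have x0 : 0 < (N - 1) / 2 by rewrite divr_gt0//; lra.
  have D := Gamma_duplication x0.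
  rewrite (_ : (N - 1) / 2 + 2^-1 = N / 2) in D; last by field.
  rewrite (_ : 2 * ((N - 1) / 2) = N - 1) in D; last by field.
  have G1 := Gamma_gt0 q0.
  have G2 := Gamma_gt0 N2.
  have N1' : 0 < N - 1 by rewrite subr_gt0.
  have G3 := Gamma_gt0 N1'.
  have D' : Gamma ((N - 1) / 2) = 2 `^ (1 - (N - 1)) * Num.sqrt pi * Gamma (N - 1) / Gamma (N / 2).
    by rewrite -D; apply/esym/mulfK/lt0r_neq0.
  rewrite /k1 /k2 /k3 /kernel_const (_ : N / 2 - 2^-1 = (N - 1) / 2); last by field.
  rewrite D' exprS.
  have S : Num.sqrt pi * Num.sqrt pi = pi :> R by rewrite -expr2 sqr_sqrtr// pi_ge0.
  rewrite -[X in X * pi ^+ n]S.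
  rewrite four.
  move: (pi ^+ n) (2 `^ N) (2 `^ (1 - (N - 1))) (Num.sqrt pi) (Gamma (N - 1)) (Gamma (N / 2)) (Gamma (n%:R + b)) (Gamma b) (Gamma (1 + alpha - b)) G1 G2 G3.
  move=> a0 a1 a2 a3 a4 a5 a6 a7 a8 G1 G2 G3.
  by field; rewrite !gt_eqF.
clearbody k1 k2 k3.
apply: eq_integral => t _.
have mIt : measurable_fun setT (fun w : rT * rT => (kernel0 (t, w) * posp (- b) w.1)%:E).
  by apply: (measurableT_comp mI); exact: pair1_measurable.
rewrite (@integral_sfproduct _ _ rT rT R mu mu (fun w => (kernel0 (t, w) * posp (- b) w.1)%:E))//.
have B0 : 0 < 1 + normsq t by rewrite ltr_pwDl ?normsq_ge0.
transitivity (\int[mu]_s ((2 `^ N * k1)%:E * (posp (alpha - b) s * ((1 + normsq t) + posp 1 s) `^ (- (N - 1)))%:E))%E; last first.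
  rewrite ge0_integralZl_EFin; last 4 first.
  - by [].
  - by move=> s _; rewrite lee_fin mulr_ge0 ?posp_ge0 ?powR_ge0.
  - by apply/measurable_EFinP; meas.
  - by rewrite mulr_ge0 ?powR_ge0.
  by rewrite step2// -!EFinM; congr EFin; rewrite mulrA.
apply: eq_integral => s _; rewrite /kernel0/=.
have [s0|s0] := ltP 0 s; last first.
  rewrite !(posp_le0E _ s0) mul0r mule0; apply: integral0_eq => u _.
  by rewrite mulr0.
have A0 : 0 < 1 + s + normsq t by rewrite ltr_pwDl ?normsq_ge0// addr_gt0.
transitivity (\int[mu]_u ((2 `^ N * posp (alpha - b) s)%:E *
    (((1 + s + normsq t) ^+ 2 + u ^+ 2) `^ (- (N / 2)))%:E))%E.
  apply: eq_integral => u _; rewrite -EFinM; congr EFin.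
  by rewrite pospD; move: (_ `^ _) (_ `^ _) (posp _ _) (posp _ _) => *; ring.
rewrite ge0_integralZl_EFin; last 4 first.
- by [].
- by move=> u _; rewrite lee_fin powR_ge0.
- by apply/measurable_EFinP; meas.
- by rewrite mulr_ge0 ?powR_ge0 ?posp_ge0.
rewrite step1// -!EFinM; congr EFin; rewrite (posp_gt0E 1)// powRr1 ?(ltW s0)//.
have -> : 1 + s + normsq t = 1 + normsq t + s by ring.
have -> : 1 - N = - (N - 1) by ring.
by move: (_ `^ _) (_ `^ _) (posp _ _) => *; ring.
Qed.

Lemma integral_T_kernel_height z b : -1 < alpha -> 0 < b -> b < 1 + alpha ->
  0 < height z ->
  (\int[dV R n]_(w in @siegel R n) (T_kernel alpha z w * posp (- b) (height w))%:E =
   (kernel_const b * posp (- b) (height z))%:E)%E.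
Proof.
move=> alpha1 b0 ba hz.
rewrite integral_T_kernel//; last 2 first.
- exact: (measurableT_comp (@measurable_posp _ _) measurable_height).
- by move=> w; exact: posp_ge0.
rewrite mulrC EFinM -integral_kernel0// -ge0_integralZl_EFin; last 4 first.
- by [].
- by move=> w _; rewrite lee_fin mulr_ge0 ?posp_ge0 ?kernel0_ge0.
- have m1 : measurable_fun setT (fun w : W => w.2.1 : R).
    exact: (measurableT_comp (@measurable_fst _ _ _ _)).
  by apply/measurable_EFinP; have := measurable_kernel0 => mk; meas.
- exact: posp_ge0.
apply: eq_integral => w _; rewrite height_transport pospM// (posp_gt0E _ hz).
by rewrite -EFinM mulrCA.
Qed.

(** |rho| is symmetric, so that swapping the arguments only moves the factor
    height^alpha from one to the other. *)
Lemma T_kernel_sym z (w : Cn1) : 0 < height z -> 0 < height w ->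
  T_kernel alpha w z = posp alpha (height z) * posp (- alpha) (height w) * T_kernel alpha z w.
Proof.
move=> hz hw; rewrite /T_kernel !Re_rho_diag normc_rho_sym !posp_gt0E// powRN.
have := powR_gt0 alpha hw => /lt0r_neq0 h.
by rewrite mulrA -(mulrA (_ `^ _) _^-1) mulVf// mulr1.
Qed.

(** By [T_kernel_sym], integrating in the first variable against height^(b-1)
    amounts to integrating in the second one against height^(alpha + b - 1),
    which is height^-(1 + alpha - b). *)
Lemma integral_T_kernel_height_dual (w : Cn1) b : -1 < alpha -> 0 < b -> b < 1 + alpha ->
  0 < height w ->
  (\int[dV R n]_(z in @siegel R n) (T_kernel alpha z w * posp (b - 1) (height z))%:E =
   (kernel_const (1 + alpha - b) * posp (b - 1) (height w))%:E)%E.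
Proof.
move=> alpha1 b0 ba hw.
have b'0 : 0 < 1 + alpha - b by lra.
have b'1 : 1 + alpha - b < 1 + alpha by lra.
transitivity (\int[dV R n]_(z in @siegel R n) ((posp alpha (height w))%:E *
    (T_kernel alpha w z * posp (- (1 + alpha - b)) (height z))%:E))%E.
  apply: eq_integral => z; rewrite inE siegelE => hz.
  rewrite -EFinM; congr EFin; rewrite (@T_kernel_sym w z hw hz).
  have -> : b - 1 = alpha + - (1 + alpha - b) by ring.
  rewrite pospD; have P1 : posp (- alpha) (height z) * posp alpha (height z) = 1.
    by rewrite -pospD addNr posp_gt0E// powRr0.
  rewrite [LHS](_ : _ = posp alpha (height w) * (T_kernel alpha w z *
    posp (- (1 + alpha - b)) (height z)) * (posp (- alpha) (height z) * posp alpha (height z))).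
    by rewrite P1 mulr1.
  by ring.
rewrite ge0_integralZl_EFin; last 4 first.
- exact: measurable_siegel.
- by move=> z _; rewrite lee_fin mulr_ge0 ?posp_ge0 ?T_kernel_ge0.
- apply: measurable_funTS; apply/measurable_EFinP; apply: measurable_funM.
    exact: (measurableT_comp measurable_T_kernel (@pair1_measurable _ _ _ _ w)).
  exact: (measurableT_comp (@measurable_posp _ _) measurable_height).
- exact: posp_ge0.
rewrite integral_T_kernel_height// -EFinM; congr EFin.
have -> : b - 1 = alpha + - (1 + alpha - b) by ring.
by rewrite [in RHS]pospD mulrCA.
Qed.

End SiegelCoord.

(** * The Schur test *)

Section WeightedHolder.
Context d (X : measurableType d) (R : realType).
Variable m : {measure set X -> \bar R}.

(** Hoelder for the factorisation
    k g = (k h^(1-p) g^p)^(1/p) (k h)^(1/q), with 1/p + 1/q = 1.  Where h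
    vanishes this needs k = 0. *)
Lemma integral_weighted_holder (k h g : X -> R) (p B : R) : 1 <= p ->
  measurable_fun setT k -> measurable_fun setT h -> measurable_fun setT g ->
  (forall y, 0 <= k y) -> (forall y, 0 <= h y) -> (forall y, 0 <= g y) ->
  (forall y, 0 < h y \/ k y = 0) -> 0 <= B ->
  (\int[m]_y (k y * h y)%:E <= B%:E)%E ->
  ((\int[m]_y (k y * g y)%:E) `^ p <=
   (B `^ (p - 1))%:E * \int[m]_y (k y * (h y `^ (1 - p) * g y `^ p))%:E)%E.
Proof.
move=> p1 mk mh mg k0 h0 g0 hk B0 HB.
have p0 : 0 < p by exact: lt_le_trans ltr01 p1.
have kg0 : (0 <= \int[m]_y (k y * g y)%:E)%E.
  by apply: integral_ge0 => y _; rewrite lee_fin mulr_ge0.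
have [->|pn1] := eqVneq p 1.
  rewrite subrr powRr0 mul1e poweRe1//.
  rewrite le_eqVlt; apply/orP; left; apply/eqP.
  by apply: eq_integral => y _; rewrite powRr0 mul1r powRr1.
have {pn1}p1' : 1 < p by rewrite lt_neqAle eq_sym pn1.
have pm1 : 0 < p - 1 by rewrite subr_gt0.
pose q := p / (p - 1).
have q0 : 0 < q by rewrite divr_gt0.
have pq : p^-1 + q^-1 = 1 by rewrite /q; field; rewrite !gt_eqF.
pose F (y : X) := k y * (h y `^ (1 - p) * g y `^ p).
pose G (y : X) := k y * h y.
have F0 y : 0 <= F y by rewrite !mulr_ge0 ?powR_ge0.
have G0 y : 0 <= G y by rewrite mulr_ge0.
have mF : measurable_fun setT F by rewrite /F; meas.
have mG : measurable_fun setT G by rewrite /G; meas.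
have FG y : k y * g y = F y `^ p^-1 * G y `^ q^-1.
  have [hy|ky] := hk y; last first.
    by rewrite /F /G ky !mul0r powR0 ?mul0r// invr_neq0// gt_eqF.
  rewrite /F /G !powRM ?mulr_ge0 ?powR_ge0// -!powRrM mulfV ?gt_eqF// powRr1//.
  rewrite mulrACA -powRD; last by rewrite pq oner_eq0.
  rewrite pq powRr1// mulrAC -powRD ?(gt_eqF hy) ?implybT//.
  rewrite (_ : (1 - p) / p + q^-1 = 0); last by rewrite /q; field; rewrite !gt_eqF.
  by rewrite powRr0 mul1r.
have := @hoelder _ X R m (fun y => F y `^ p^-1) (fun y => G y `^ q^-1) p q.
have mF' : measurable_fun setT (fun y => F y `^ p^-1) by meas.
have mG' : measurable_fun setT (fun y => G y `^ q^-1) by meas.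
move=> /(_ mF' mG' p0 q0 pq).
rewrite Lnorm1.
have -> : (\int[m]_x `|(((fun y => F y `^ p^-1) \* (fun y => G y `^ q^-1)) x)%:E| =
    \int[m]_y (k y * g y)%:E)%E.
  apply: eq_integral => y _; rewrite /= -FG ger0_norm// mulr_ge0//.
have NF : ('N[m]_p%:E[EFin \o (fun y => F y `^ p^-1)%R] `^ p = \int[m]_y (F y)%:E)%E.
  rewrite poweR_Lnorm ?gt_eqF//; apply: eq_integral => y _ /=.
  rewrite ger0_norm ?powR_ge0// -powRrM mulVf ?gt_eqF// powRr1//.
have NG : ('N[m]_q%:E[EFin \o (fun y => G y `^ q^-1)%R] `^ q = \int[m]_y (G y)%:E)%E.
  rewrite poweR_Lnorm ?gt_eqF//; apply: eq_integral => y _ /=.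
  rewrite ger0_norm ?powR_ge0// -powRrM mulVf ?gt_eqF// powRr1//.
move=> HH.
have : ((\int[m]_y (k y * g y)%:E) `^ p <=
  ('N[m]_p%:E[EFin \o (fun y => F y `^ p^-1)%R] * 'N[m]_q%:E[EFin \o (fun y => G y `^ q^-1)%R]) `^ p)%E.
  by apply: gt0_ler_poweR => //; rewrite ?(ltW p0)// in_itv/= leey andbT ?mule_ge0 ?Lnorm_ge0.
move=> /le_trans; apply.
rewrite poweRM ?Lnorm_ge0// NF muleC; apply: lee_wpmul2r.
  by apply: integral_ge0 => y _; rewrite lee_fin.
have -> : p = q * (p - 1) by rewrite /q; field; rewrite gt_eqF.
rewrite poweRrM NG.
have -> : q * (p - 1) - 1 = p - 1 by rewrite /q; field; rewrite gt_eqF.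
rewrite -poweR_EFin; apply: gt0_ler_poweR => //; rewrite ?(ltW pm1)// in_itv/= leey andbT//.
by apply: integral_ge0 => y _; rewrite lee_fin.
Qed.

End WeightedHolder.

Section Schur.
Context d (X : measurableType d) (R : realType).
Variable m : {sigma_finite_measure set X -> \bar R}.
Variables (k : X * X -> R) (h : X -> R) (p A : R).
Hypothesis p1 : 1 <= p.
Hypotheses (mk : measurable_fun setT k) (mh : measurable_fun setT h).
Hypotheses (k0 : forall z, 0 <= k z) (h0 : forall x, 0 <= h x) (A0 : 0 <= A).
Hypothesis hk : forall x y, 0 < h y \/ k (x, y) = 0.
Hypothesis H1 : forall x, (\int[m]_y (k (x, y) * h y)%:E <= (A * h x)%:E)%E.
Hypothesis H2 : forall y,
  (\int[m]_x (k (x, y) * h x `^ (p - 1))%:E <= (A * h y `^ (p - 1))%:E)%E.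

(** Apply [integral_weighted_holder] for each x with the bound A h(x), exchange
    the integrals, and apply the second hypothesis: the powers of h cancel and
    the constant is A^(p-1) A. *)
Lemma schur_test (g : X -> R) : measurable_fun setT g -> (forall y, 0 <= g y) ->
  (\int[m]_x ((\int[m]_y (k (x, y) * g y)%:E) `^ p) <=
   (A `^ p)%:E * \int[m]_y (g y `^ p)%:E)%E.
Proof.
move=> mg g0.
have mk1 x : measurable_fun setT (fun y => k (x, y)).
  exact: (measurableT_comp mk (@pair1_measurable _ _ _ _ x)).
have mk2 y : measurable_fun setT (fun x => k (x, y)).
  exact: (measurableT_comp mk (@pair2_measurable _ _ _ _ y)).
have mh1 : measurable_fun setT (fun z : X * X => h z.1).
  exact: (measurableT_comp mh (@measurable_fst _ _ _ _)).
have mh2 : measurable_fun setT (fun z : X * X => h z.2).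
  exact: (measurableT_comp mh (@measurable_snd _ _ _ _)).
have mg2 : measurable_fun setT (fun z : X * X => g z.2).
  exact: (measurableT_comp mg (@measurable_snd _ _ _ _)).
pose K (z : X * X) : \bar R :=
  ((A * h z.1) `^ (p - 1) * (k z * (h z.2 `^ (1 - p) * g z.2 `^ p)))%:E.
have mK : measurable_fun setT K by apply/measurable_EFinP; meas.
have K0 z : (0 <= K z)%E by rewrite lee_fin !mulr_ge0 ?powR_ge0.
apply: (@le_trans _ _ (\int[m]_x \int[m]_y K (x, y))%E).
  apply: ge0_le_integral => //.
  - by move=> x _; exact: poweR_ge0.
  - apply: (@measurableT_comp _ _ _ _ _ _ (fun y : \bar R => (y `^ p)%E)).
      exact: measurable_poweR.
    apply: (@measurable_integral_ge0 _ _ _ _ _ m (fun z : X * X => (k z * g z.2)%:E)).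
      by apply/measurable_EFinP; meas.
    by move=> z; rewrite lee_fin mulr_ge0.
  - exact: (@measurable_integral_ge0 _ _ _ _ _ m K).
  - move=> x _; apply: le_trans.
      apply: (integral_weighted_holder (h := h) (B := A * h x) p1) => //.
      by rewrite mulr_ge0.
    rewrite -ge0_integralZl_EFin//.
    + by move=> y _; rewrite lee_fin !mulr_ge0 ?powR_ge0.
    + by apply/measurable_EFinP; have := mk1 x => mk1x; meas.
    + exact: powR_ge0.
rewrite fubini_tonelli// -ge0_integralZl_EFin; last 4 first.
- by [].
- by move=> y _; rewrite lee_fin powR_ge0.
- by apply/measurable_EFinP; meas.
- exact: powR_ge0.
apply: ge0_le_integral => //.
- by move=> y _; apply: integral_ge0.
- exact: (@measurable_fun_fubini_tonelli_G _ _ X X R m K).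
- by apply/measurable_funeM/measurable_EFinP; meas.
move=> y _; rewrite /K/=.
have E : (\int[m]_x ((A * h x) `^ (p - 1) * (k (x, y) * (h y `^ (1 - p) * g y `^ p)))%:E =
   (A `^ (p - 1) * (h y `^ (1 - p) * g y `^ p))%:E * \int[m]_x (k (x, y) * h x `^ (p - 1))%:E)%E.
  rewrite -ge0_integralZl_EFin; last 4 first.
  - by [].
  - by move=> x _; rewrite lee_fin mulr_ge0 ?powR_ge0.
  - by apply/measurable_EFinP; have := mk2 y => mk2y; meas.
  - by rewrite !mulr_ge0 ?powR_ge0.
  apply: eq_integral => x _; rewrite -EFinM; congr EFin.
  by rewrite powRM//; move: (_ `^ _) (_ `^ _) (_ `^ _) (_ `^ _) => *; ring.
rewrite E; apply: (@le_trans _ _ ((A `^ (p - 1) * (h y `^ (1 - p) * g y `^ p))%:E * (A * h y `^ (p - 1))%:E)%E).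
  by apply: lee_wpmul2l => //; rewrite lee_fin !mulr_ge0 ?powR_ge0.
rewrite -!EFinM lee_fin.
have p0 : 0 < p by exact: lt_le_trans ltr01 p1.
rewrite -(mulr_powRB1 A0 p0).
have Hh : h y `^ (1 - p) * h y `^ (p - 1) <= 1.
  have := h0 y; rewrite le_eqVlt => /orP[/eqP <-|hy].
    have [->|pn1] := eqVneq p 1; first by rewrite subrr powRr0 mulr1.
    by rewrite powR0 ?mul0r// subr_eq0 eq_sym.
  by rewrite -powRD ?(gt_eqF hy) ?implybT// (_ : 1 - p + (p - 1) = 0) ?powRr0//; ring.
rewrite [leLHS](_ : _ = (A * A `^ (p - 1) * g y `^ p) * (h y `^ (1 - p) * h y `^ (p - 1))); last first.
  by move: (_ `^ _) (_ `^ _) (_ `^ _) (_ `^ _) => *; ring.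
by rewrite -[leRHS]mulr1; apply: ler_wpM2l => //; rewrite !mulr_ge0 ?powR_ge0.
Qed.

End Schur.

(** * Complex integrals and p-norms *)

Section ComplexIntegral.
Context d (T : measurableType d) (R : realType).
Variables (mu : {measure set T -> \bar R}) (D : set T).
Hypothesis mD : measurable D.
Local Notation C := R[i].

Lemma integral_mul_indic (f : T -> R) :
  (\int[mu]_(x in D) (f x)%:E = \int[mu]_x (f x * \1_D x)%:E)%E.
Proof.
rewrite integral_mkcond; apply: eq_integral => x _.
by rewrite patchE indicE; case: (x \in D); rewrite ?mulr1 ?mulr0.
Qed.

Lemma measurable_complexP (f : T -> C) :
  measurable_fun D (fun x => complex.Re (f x)) ->
  measurable_fun D (fun x => complex.Im (f x)) -> measurable_fun D f.
Proof.
move=> mR mI.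
have mR' := (measurable_restrictT _ mD).1 mR.
have mI' := (measurable_restrictT _ mD).1 mI.
apply: (eq_measurable_fun (fun x => Complex (((fun x => complex.Re (f x)) \_ D) x)
                                            (((fun x => complex.Im (f x)) \_ D) x))).
  by move=> x Dx; rewrite !patchE Dx; case: (f x).
by apply: measurable_funTS; exact: measurable_Complex.
Qed.

(** Cauchy-Schwarz in the plane, from Lagrange's identity. *)
Lemma dot_le_normc (a b x y : R) :
  a * x + b * y <= normc (Complex a b) * normc (Complex x y).
Proof.
rewrite /= -sqrtrM ?addr_ge0 ?sqr_ge0//.
apply: (le_trans (ler_norm _)); rewrite -sqrtr_sqr ler_wsqrtr//.
have : 0 <= (a * y - b * x) ^+ 2 by exact: sqr_ge0.
by nra.
Qed.

Lemma normRe (z : C) : `|complex.Re z| <= normc z.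
Proof. by case: z => a b /=; rewrite -sqrtr_sqr ler_wsqrtr// lerDl sqr_ge0. Qed.

Lemma normIm (z : C) : `|complex.Im z| <= normc z.
Proof. by case: z => a b /=; rewrite -sqrtr_sqr ler_wsqrtr// lerDr sqr_ge0. Qed.

Lemma integrableC_normc (f : T -> C) : measurable_fun D f ->
  (\int[mu]_(x in D) (normc (f x))%:E < +oo)%E -> integrableC mu D f.
Proof.
move=> mf foo.
have mR : measurable_fun D (fun x => (complex.Re (f x))%:E).
  by apply/measurable_EFinP; exact: (measurableT_comp (@measurable_Re R)).
have mI : measurable_fun D (fun x => (complex.Im (f x))%:E).
  by apply/measurable_EFinP; exact: (measurableT_comp (@measurable_Im R)).
have iN : mu.-integrable D (fun x => (normc (f x))%:E).
  apply/integrableP; split.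
    by apply/measurable_EFinP; exact: (measurableT_comp (@measurable_normc R)).
  under eq_integral do rewrite /= ger0_norm ?normc_ge0//.
  by [].
split; apply: le_integrable iN => // x _; rewrite /= lee_fin (ger0_norm (normc_ge0 _)).
  exact: normRe.
exact: normIm.
Qed.

(** With I the integral, |I|^2 is the integral of the scalar product of I and f,
    which is at most |I| |f|. *)
Lemma normc_integralC_le (f : T -> C) : measurable_fun D f ->
  ((normc (integralC mu D f))%:E <= \int[mu]_(x in D) (normc (f x))%:E)%E.
Proof.
move=> mf.
have [foo|] := boolP (\int[mu]_(x in D) (normc (f x))%:E < +oo)%E; last first.
  by rewrite -leNgt leye_eq => /eqP ->; exact: leey.
have [iR iI] := integrableC_normc mf foo.
have iN : mu.-integrable D (EFin \o (fun x => normc (f x))).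
  apply/integrableP; split.
    by apply/measurable_EFinP; exact: (measurableT_comp (@measurable_normc R)).
  under eq_integral do rewrite /= ger0_norm ?normc_ge0//.
  by [].
have N0 : (0 <= \int[mu]_(x in D) (normc (f x))%:E)%E.
  by apply: integral_ge0 => x _; rewrite lee_fin normc_ge0.
rewrite -[leRHS]fineK ?ge0_fin_numE// lee_fin.
set I := integralC mu D f; set M := normc I; set J := fine _.
have M0 : 0 <= M by exact: normc_ge0.
have [->|Mn0] := eqVneq M 0; first by rewrite fine_ge0.
have Mp : 0 < M by rewrite lt_neqAle eq_sym Mn0.
rewrite -(ler_pM2l Mp).
have -> : M * M = complex.Re I * complex.Re I + complex.Im I * complex.Im I.
  by rewrite -!expr2 /M normc_sqr.
rewrite /I /integralC/=.
set a := Rintegral _ _ _; set b := Rintegral _ _ _.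
have iZ (c : R) (u : T -> R) : mu.-integrable D (fun x => (u x)%:E) ->
    mu.-integrable D (EFin \o (fun x => c * u x)).
  by move=> iu; apply: eq_integrable (integrableZl mD c iu).
rewrite {2}/a {2}/b -!RintegralZl// -RintegralD//; last 2 first.
- exact: iZ.
- exact: iZ.
apply: le_Rintegral => //.
- exact: (@integrableD _ _ _ mu D mD (fun x => (a * complex.Re (f x))%:E) (fun x => (b * complex.Im (f x))%:E) (iZ a _ iR) (iZ b _ iI)).
- exact: iZ.
- move=> x _; rewrite /M /I /integralC -/a -/b.
  by case: (f x) => x1 x2; exact: dot_le_normc.
Qed.

Lemma patch_normc_ge0 (f : T -> C) x : 0 <= ((fun x => normc (f x)) \_ D) x.
Proof. by rewrite patchE; case: ifP => // _; exact: normc_ge0. Qed.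

Lemma measurable_patch_normc (f : T -> C) : measurable_fun D f ->
  measurable_fun setT ((fun x => normc (f x)) \_ D).
Proof.
move=> mf; apply: (measurable_restrictT _ _).1 => //.
exact: (measurableT_comp (@measurable_normc R)).
Qed.

Variable p : R.
Hypothesis p1 : 1 <= p.
Let p0 : 0 < p. Proof. exact: lt_le_trans ltr01 p1. Qed.

Lemma poweR_normLp (f : T -> C) :
  (normLp mu D p f `^ p = \int[mu]_x (((fun x => normc (f x)) \_ D) x `^ p)%:E)%E.
Proof.
rewrite /normLp poweR_Lnorm ?gt_eqF//; apply: eq_integral => x _.
have -> : (fun x => (normc (f x))%:E) = EFin \o (fun x => normc (f x)) by [].
by rewrite restrict_EFin /= ger0_norm ?patch_normc_ge0.
Qed.

Lemma normLp_ge0 (f : T -> C) : (0 <= normLp mu D p f)%E.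
Proof. exact: Lnorm_ge0. Qed.

Lemma ler_poweR (x y : \bar R) : (0 <= x)%E -> (0 <= y)%E ->
  (x `^ p <= y `^ p)%E -> (x <= y)%E.
Proof.
move=> x0 y0 xy; rewrite -[x]poweRe1// -[y]poweRe1//.
have E : 1 = p * p^-1 by rewrite mulfV// gt_eqF.
rewrite E !poweRrM; apply: gt0_ler_poweR => //; rewrite ?invr_ge0 ?(ltW p0)//.
  by rewrite in_itv/= leey poweR_ge0.
by rewrite in_itv/= leey poweR_ge0.
Qed.

End ComplexIntegral.

Section MeasurableParam.
Context d1 d2 (T1 : measurableType d1) (T2 : measurableType d2) (R : realType).

(** The functions of L^p have real and imaginary parts of any sign, which
    Tonelli does not cover; one splits into positive and negative parts. *)
Lemma measurable_integral_param (m2 : {sigma_finite_measure set T2 -> \bar R})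
    (h : T1 * T2 -> \bar R) :
  measurable_fun setT h -> measurable_fun setT (fun x => \int[m2]_y h (x, y))%E.
Proof.
move=> mh.
under eq_fun do rewrite integralE.
have mp := measurable_funepos mh; have mn := measurable_funeneg mh.
have Hp := @measurable_integral_ge0 _ _ T1 T2 R m2 _ mp (fun z => funepos_ge0 h z).
have Hn := @measurable_integral_ge0 _ _ T1 T2 R m2 _ mn (fun z => funeneg_ge0 h z).
rewrite (_ : (fun x => _) = (fun x => \int[m2]_y h^\+ (x, y) - \int[m2]_y h^\- (x, y))%E).
  exact: emeasurable_funB Hp Hn.
by apply/funext => x; congr (_ - _)%E; apply: eq_integral => y _; rewrite unlock.
Qed.

End MeasurableParam.

(** * The upper bound *)

Section Upper.
Context (R : realType) (n : nat) (alpha p : R).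
Hypotheses (alpha1 : -1 < alpha) (p1 : 1 <= p) (pa : 1 < p * (1 + alpha)).
Local Notation C := R[i].
Local Notation Cn1 := (n.-tuple C * C)%type.
Local Notation U := (@siegel R n).
Local Notation V := (dV R n).
Local Notation N := (n%:R + 2 + alpha).
Local Notation A := (kernel_const n alpha p^-1).

Let p0 : 0 < p. Proof. exact: lt_le_trans ltr01 p1. Qed.
Let a1 : 0 < 1 + alpha. Proof. by rewrite -ltrBlDl sub0r. Qed.
Let b0 : 0 < p^-1. Proof. by rewrite invr_gt0. Qed.
Let ba : p^-1 < 1 + alpha.
Proof. by rewrite -[ltLHS]mul1r ltr_pdivrMr// mulrC. Qed.

Let N20 : 0 < N / 2.
Proof.
rewrite divr_gt0// -addrA ltr_wpDl//.
have -> : 2 + alpha = 1 + (1 + alpha) by ring.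
by rewrite addr_gt0.
Qed.

Definition T_const : R := (n.+1)`!%:R / (4 * pi ^+ n.+1).

Lemma T_const_gt0 : 0 < T_const.
Proof.
by rewrite divr_gt0 ?ltr0n ?fact_gt0// mulr_gt0// exprn_gt0// pi_gt0.
Qed.

Lemma kernel_const_gt0 (b : R) : 0 < b -> b < 1 + alpha -> 0 < kernel_const n alpha b.
Proof.
move=> hb hba; have h1 : 0 < 1 + alpha - b by rewrite subr_gt0.
have g1 := Gamma_gt0 h1; have g2 := Gamma_gt0 N20; have g3 := Gamma_gt0 hb.
apply: divr_gt0; last exact: exprn_gt0.
apply: mulr_gt0 g3; apply: mulr_gt0 g1; apply: mulr_gt0 => //.
by rewrite exprn_gt0// pi_gt0.
Qed.

Lemma T_const_kernel_const : T_const * A =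
  (n.+1)`!%:R * Gamma (1 + alpha - p^-1) * Gamma p^-1 / Gamma (N / 2) ^+ 2.
Proof.
have g2 := Gamma_gt0 N20.
have pn : 0 < pi ^+ n.+1 :> R by rewrite exprn_gt0// pi_gt0.
rewrite /T_const /kernel_const.
move: (pi ^+ n.+1) (Gamma (N / 2)) (Gamma (1 + _ - _)) (Gamma p^-1) ((n.+1)`!%:R) pn g2.
by move=> x1 x2 x3 x4 x5 pn g2; field; rewrite !gt_eqF.
Qed.

(** Extension by 0 of the kernel, to put the Schur test on the whole space. *)
Definition kernelU (z : Cn1 * Cn1) : R := T_kernel alpha z.1 z.2 * \1_U z.1 * \1_U z.2.

Lemma kernelU_ge0 z : 0 <= kernelU z.
Proof. by apply: mulr_ge0; [apply: mulr_ge0 => //; exact: T_kernel_ge0|]. Qed.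

Lemma measurable_kernelU : measurable_fun setT kernelU.
Proof.
have m1 : measurable_fun setT (\1_U : Cn1 -> R) by apply: measurable_indic; exact: measurable_siegel.
have mi1 : measurable_fun setT (fun z : Cn1 * Cn1 => \1_U z.1 : R).
  exact: (measurableT_comp m1 (@measurable_fst _ _ _ _)).
have mi2 : measurable_fun setT (fun z : Cn1 * Cn1 => \1_U z.2 : R).
  exact: (measurableT_comp m1 (@measurable_snd _ _ _ _)).
by have := @measurable_T_kernel R n alpha => mT; rewrite /kernelU; meas.
Qed.

Definition weight (z : Cn1) : R := posp (- p^-1) (height z).

(** On the domain this is an equality: the weight is an eigenfunction. *)
Lemma kernelU_row_test x :
  (\int[V]_y (kernelU (x, y) * weight y)%:E <= (A * weight x)%:E)%E.
Proof.
have [hx|hx] := ltP 0 (height x).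
  rewrite /weight -integral_T_kernel_height// [leRHS]integral_mul_indic.
  rewrite le_eqVlt; apply/orP; left; apply/eqP; apply: eq_integral => y _; congr EFin.
  rewrite /kernelU/= indicE mem_set; last exact/siegelE.
  by rewrite mulr1 mulrAC.
rewrite /weight (posp_le0E _ hx) mulr0 integral0_eq// => y _.
rewrite /kernelU/= indicE memNset ?mulr0 ?mul0r//.
by rewrite siegelE => /lt_le_trans/(_ hx); rewrite ltxx.
Qed.

Lemma kernel_const_sym (b : R) : kernel_const n alpha (1 + alpha - b) = kernel_const n alpha b.
Proof.
rewrite /kernel_const.
have -> : 1 + alpha - (1 + alpha - b) = b by ring.
exact: (congr1 (fun x => x / _) (mulrAC _ _ _)).
Qed.

(** weight^(p-1) is height^(1/p - 1), so that the dual eigenfunction identity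
    applies with b = 1/p; its constant is the one of [kernelU_row_test] by
    [kernel_const_sym]. *)
Lemma kernelU_column_test y :
  (\int[V]_x (kernelU (x, y) * weight x `^ (p - 1))%:E <= (A * weight y `^ (p - 1))%:E)%E.
Proof.
have [hy|hy] := ltP 0 (height y); last first.
  rewrite integral0_eq; first by rewrite lee_fin mulr_ge0 ?powR_ge0// ltW// kernel_const_gt0.
  move=> x _; rewrite /kernelU/= [\1_U y]indicE memNset ?mulr0 ?mul0r//.
  by rewrite siegelE => /lt_le_trans/(_ hy); rewrite ltxx.
have W (x : Cn1) : 0 < height x -> weight x `^ (p - 1) = posp (p^-1 - 1) (height x).
  move=> hx; rewrite /weight !posp_gt0E// -powRrM; congr (_ `^ _).
  by field; rewrite gt_eqF.
rewrite W// -kernel_const_sym -integral_T_kernel_height_dual// [leRHS]integral_mul_indic.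
rewrite le_eqVlt; apply/orP; left; apply/eqP; apply: eq_integral => x _; congr EFin.
rewrite /kernelU/= [\1_U y]indicE mem_set ?mulr1; last exact/siegelE.
rewrite indicE; have [/set_mem/siegelE hx|_] := boolP (x \in U).
  by rewrite W// !mulr1.
by rewrite !mulr0 mul0r.
Qed.

Lemma weight_gt0_or_kernelU0 (x y : Cn1) : 0 < weight y \/ kernelU (x, y) = 0.
Proof.
have [hy|hy] := ltP 0 (height y).
  by left; rewrite /weight posp_gt0E// powR_gt0.
right; rewrite /kernelU/= [\1_U y]indicE memNset ?mulr0//.
by rewrite siegelE => /lt_le_trans/(_ hy); rewrite ltxx.
Qed.

Section WithF.
Variable f : Cn1 -> C.
Hypothesis mf : measurable_fun U f.
Let g : Cn1 -> R := (fun x => normc (f x)) \_ U.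
Let mg : measurable_fun setT g.
Proof. by apply: measurable_patch_normc => //; exact: measurable_siegel. Qed.
Let g0 y : 0 <= g y. Proof. exact: patch_normc_ge0. Qed.

Lemma schur_siegel :
  (\int[V]_x ((\int[V]_y (kernelU (x, y) * g y)%:E) `^ p) <=
   (A `^ p)%:E * normLp V U p f `^ p)%E.
Proof.
rewrite (poweR_normLp _ _ p1); apply: (@schur_test _ _ R V kernelU weight) => //.
- exact: measurable_kernelU.
- exact: (measurableT_comp (@measurable_posp _ _) (@measurable_height R n)).
- exact: kernelU_ge0.
- by move=> x; exact: posp_ge0.
- by rewrite ltW// kernel_const_gt0.
- exact: weight_gt0_or_kernelU0.
- exact: kernelU_row_test.
- exact: kernelU_column_test.
Qed.

Let mKf z : measurable_fun U (fun w => (T_kernel alpha z w)%:C%C * f w).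
Proof.
have mT : measurable_fun U (fun w => T_kernel alpha z w).
  apply: measurable_funTS.
  exact: (measurableT_comp (@measurable_T_kernel R n alpha) (@pair1_measurable _ _ _ _ z)).
have mR : measurable_fun U (fun w => complex.Re (f w)) by exact: (measurableT_comp (@measurable_Re R)).
have mI : measurable_fun U (fun w => complex.Im (f w)) by exact: (measurableT_comp (@measurable_Im R)).
apply: measurable_complexP; first exact: measurable_siegel.
- rewrite (_ : (fun x => _) = (fun w => T_kernel alpha z w * complex.Re (f w))).
    exact: measurable_funM.
  by apply/funext => w; case: (f w) => a b /=; rewrite mul0r subr0.
- rewrite (_ : (fun x => _) = (fun w => T_kernel alpha z w * complex.Im (f w))).
    exact: measurable_funM.
  by apply/funext => w; case: (f w) => a b /=; rewrite mul0r addr0.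
Qed.

Lemma normc_realM (c : R) (x : C) : 0 <= c -> normc (c%:C%C * x) = c * normc x.
Proof.
move=> c0; rewrite !normc_sqrt; case: x => a b /=.
rewrite !mul0r subr0 addr0 !exprMn -mulrDr sqrtrM ?sqr_ge0// sqrtr_sqr ger0_norm//.
Qed.

Let integral_normc_kernel z : siegel z ->
  (\int[V]_(w in U) (normc ((T_kernel alpha z w)%:C%C * f w))%:E =
   \int[V]_y (kernelU (z, y) * g y)%:E)%E.
Proof.
move=> Uz; rewrite integral_mul_indic.
apply: eq_integral => w _; congr EFin.
rewrite normc_realM ?T_kernel_ge0// /kernelU/= /g patchE !indicE (mem_set Uz).
by case: (w \in U); rewrite ?mulr0 ?mulr1// mul0r.
Qed.

Lemma normc_T_op_le z : siegel z ->
  ((normc (T_op alpha f z))%:E <= T_const%:E * \int[V]_y (kernelU (z, y) * g y)%:E)%E.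
Proof.
move=> Uz; rewrite /T_op normc_realM ?(ltW T_const_gt0)// EFinM.
apply: lee_wpmul2l; first by rewrite lee_fin ltW// T_const_gt0.
by rewrite -integral_normc_kernel//; apply: (normc_integralC_le V (@measurable_siegel R n)); exact: mKf.
Qed.

Let m_int : measurable_fun setT (fun x => \int[V]_y (kernelU (x, y) * g y)%:E)%E.
Proof.
apply: (@measurable_integral_ge0 _ _ _ _ _ V (fun z => (kernelU z * g z.2)%:E)).
  have mg2 : measurable_fun setT (fun z : Cn1 * Cn1 => g z.2).
    exact: (measurableT_comp mg (@measurable_snd _ _ _ _)).
  by have := measurable_kernelU => mk; apply/measurable_EFinP; meas.
by move=> z; rewrite lee_fin mulr_ge0// kernelU_ge0.
Qed.

Let int_ge0 x : (0 <= \int[V]_y (kernelU (x, y) * g y)%:E)%E.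
Proof. by apply: integral_ge0 => y _; rewrite lee_fin mulr_ge0// kernelU_ge0. Qed.

Lemma measurable_T_op : measurable_fun U (T_op alpha f).
Proof.
have mR : measurable_fun setT ((fun w => complex.Re (f w)) \_ U).
  apply: (measurable_restrictT _ _).1; first exact: measurable_siegel.
  exact: (measurableT_comp (@measurable_Re R)).
have mI : measurable_fun setT ((fun w => complex.Im (f w)) \_ U).
  apply: (measurable_restrictT _ _).1; first exact: measurable_siegel.
  exact: (measurableT_comp (@measurable_Im R)).
have H (u : Cn1 -> R) : measurable_fun setT u ->
    measurable_fun U (fun z => T_const * fine (\int[V]_w (T_kernel alpha z w * u w)%:E)%E).
  move=> mu; apply: measurable_funTS; apply: measurable_funM => //.
  apply: measurableT_comp => //.
  apply: (@measurable_integral_param _ _ _ _ _ V (fun z => (T_kernel alpha z.1 z.2 * u z.2)%:E)).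
  have mu2 : measurable_fun setT (fun z : Cn1 * Cn1 => u z.2).
    exact: (measurableT_comp mu (@measurable_snd _ _ _ _)).
  by have := @measurable_T_kernel R n alpha => mk; apply/measurable_EFinP; meas.
apply: measurable_complexP; first exact: measurable_siegel.
- rewrite (_ : (fun x => _) = (fun z => T_const * fine (\int[V]_w (T_kernel alpha z w * ((fun w => complex.Re (f w)) \_ U) w)%:E)%E)); first exact: H.
  apply/funext => z; rewrite /T_op /integralC/= mul0r subr0; congr (_ * _).
  rewrite /Rintegral integral_mkcond; congr fine; apply: eq_integral => w _.
  rewrite !patchE; case: (w \in U); last by rewrite mulr0.
  by case: (f w) => a b /=; rewrite mul0r subr0.
- rewrite (_ : (fun x => _) = (fun z => T_const * fine (\int[V]_w (T_kernel alpha z w * ((fun w => complex.Im (f w)) \_ U) w)%:E)%E)); first exact: H.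
  apply/funext => z; rewrite /T_op /integralC/= mul0r addr0; congr (_ * _).
  rewrite /Rintegral integral_mkcond; congr fine; apply: eq_integral => w _.
  rewrite !patchE; case: (w \in U); last by rewrite mulr0.
  by case: (f w) => a b /=; rewrite mul0r addr0.
Qed.

Lemma normLp_T_op_le :
  (normLp V U p (T_op alpha f) <= (T_const * A)%:E * normLp V U p f)%E.
Proof.
have A0 : 0 <= A by rewrite ltW// kernel_const_gt0.
have c0 := ltW T_const_gt0.
apply: (ler_poweR p1); [exact: normLp_ge0|by rewrite mule_ge0 ?normLp_ge0// lee_fin mulr_ge0|].
have -> : (((T_const * A)%:E * normLp V U p f) `^ p =
    (T_const `^ p)%:E * ((A `^ p)%:E * normLp V U p f `^ p))%E.
  rewrite poweRM; [|by rewrite lee_fin mulr_ge0|exact: normLp_ge0].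
  by rewrite muleA -EFinM -powRM.
apply: (@le_trans _ _ ((T_const `^ p)%:E * \int[V]_x ((\int[V]_y (kernelU (x, y) * g y)%:E) `^ p))%E); last first.
  by apply: lee_wpmul2l; [rewrite lee_fin powR_ge0|exact: schur_siegel].
rewrite poweR_normLp// -ge0_integralZl_EFin; last 4 first.
- by [].
- by move=> x _; exact: poweR_ge0.
- by apply: (@measurableT_comp _ _ _ _ _ _ (fun y : \bar R => (y `^ p)%E)) => //; exact: measurable_poweR.
- exact: powR_ge0.
apply: ge0_le_integral => //.
- by move=> x _; rewrite lee_fin powR_ge0.
- apply/measurable_EFinP.
  have := measurable_patch_normc (@measurable_siegel R n) measurable_T_op => mp.
  exact: (measurableT_comp (@measurable_powR R p) mp).
- apply: measurable_funeM.
  by apply: (@measurableT_comp _ _ _ _ _ _ (fun y : \bar R => (y `^ p)%E)) => //; exact: measurable_poweR.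
move=> x _; rewrite patchE; case: ifPn => [/set_mem Ux|_]; last first.
  by rewrite powR0 ?gt_eqF// mule_ge0 ?poweR_ge0// lee_fin powR_ge0.
rewrite -!poweR_EFin -poweRM// ?lee_fin//; apply: gt0_ler_poweR; rewrite ?(ltW p0)//.
- have := normc_ge0 (T_op alpha f x); move: (normc _) => y y0.
  by rewrite in_itv/= leey lee_fin y0.
- by rewrite in_itv/= leey mule_ge0// lee_fin.
- exact: normc_T_op_le.
Qed.

(** The Schur test bounds the integral of the p-th power of the absolute
    integrals, so that these are finite almost everywhere. *)
Lemma ae_integrable_T_op : (normLp V U p f < +oo)%E ->
  {ae V, forall z, siegel z -> integrableC V U (fun w => (T_kernel alpha z w)%:C%C * f w)}.
Proof.
move=> foo.
have iI : V.-integrable setT (fun x => (\int[V]_y (kernelU (x, y) * g y)%:E) `^ p)%E.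
  apply/integrableP; split.
    by apply: (@measurableT_comp _ _ _ _ _ _ (fun y : \bar R => (y `^ p)%E)) => //; exact: measurable_poweR.
  under eq_integral do rewrite gee0_abs ?poweR_ge0//.
  apply: (le_lt_trans schur_siegel).
  rewrite -ge0_fin_numE ?mule_ge0 ?poweR_ge0 ?lee_fin ?powR_ge0//.
  by rewrite fin_numM// fin_num_poweR// ge0_fin_numE// normLp_ge0.
have := integrable_ae measurableT iI.
apply: filterS => z /(_ I) zfin Uz.
apply: integrableC_normc; [exact: measurable_siegel|exact: mKf|].
rewrite integral_normc_kernel//.
rewrite ge0_fin_numE ?poweR_ge0// in zfin.
by apply: (lty_poweRy _ zfin); rewrite gt_eqF.
Qed.

End WithF.

End Upper.

(** * Boxes and their translates *)

Section Boxes.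
Context (R : realType).
Local Notation C := R[i].
Local Notation rT := (measurableTypeR R).
Notation mu := (@lebesgue_measure R).
Local Notation lambda n := (tuple_measure (lebesgueC R) n).

Definition itv_indic (a b x : R) : R := \1_(`]a, b[%classic) x.

Lemma itv_indicE a b x : itv_indic a b x = (a < x < b)%R%:R.
Proof.
rewrite /itv_indic indicE; congr (nat_of_bool _)%:R.
by apply/idP/idP => [/set_mem|h]; [|apply/mem_set]; rewrite /= in_itv.
Qed.

Lemma itv_indic_ge0 a b x : 0 <= itv_indic a b x.
Proof. by rewrite itv_indicE. Qed.

Lemma measurable_itv_indic a b : measurable_fun setT (itv_indic a b).
Proof. by apply: measurable_indic. Qed.

Lemma integral_itv_indic (a b : R) : a <= b -> (\int[mu]_x (itv_indic a b x)%:E = (b - a)%:E)%E.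
Proof.
move=> ab; rewrite /itv_indic integral_indic// setIT.
have := lebesgue_measure_itv (`]a, b[ : interval R) => /= ->.
rewrite lte_fin; case: ltP => [_|ba]; first by rewrite -EFinB.
by rewrite (@le_anti _ _ a b) ?subrr// ab ba.
Qed.

Lemma integral_itv_indic_inv (a b : R) : 0 < a -> a < b ->
  (\int[mu]_x (itv_indic a b x * posp (- 1) x)%:E = (ln b - ln a)%:E)%E.
Proof.
move=> a0 ab.
transitivity (\int[mu]_(x in `]a, b[) (x^-1)%:E)%E.
  rewrite [RHS]integral_mkcond; apply: eq_integral => x _; rewrite patchE /itv_indic indicE.
  case: ifPn => [/set_mem/=|]; last by rewrite mul0r.
  rewrite in_itv/= => /andP[ax _]; rewrite mul1r posp_gt0E ?powR_inv1//.
    by rewrite ltW// (lt_trans a0).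
  exact: lt_trans ax.
have pos x : a <= x -> 0 < x by exact: lt_le_trans.
have cV : {within `[a, b], continuous (fun x : R => x^-1)}.
  apply: continuous_in_subspaceT => x; rewrite inE/= in_itv/= => /andP[ax _].
  by apply: inv_continuous; rewrite gt_eqF// pos.
rewrite -(@integral_itv_bndoo R a b (fun x => (x^-1)%:E) true false); last first.
  apply/measurable_EFinP.
  apply: (@measurable_funS _ _ _ _ `[a, b]) => //; first exact: subset_itv_oo_cc.
  exact: subspace_continuous_measurable_fun.
rewrite (@continuous_FTC2 _ _ (@ln R) a b ab cV)//.
  split.
  - by move=> x; rewrite in_itv/= => /andP[ax _]; have [] := is_derive1_ln (lt_trans a0 ax).
  - by apply: cvg_at_right_filter; apply: continuous_ln.
  - by apply: cvg_at_left_filter; apply: continuous_ln; exact: lt_trans ab.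
by move=> x; rewrite in_itv/= => /andP[ax _]; rewrite derive1E; have [_ ->] := is_derive1_ln (lt_trans a0 ax).
Qed.

Definition cube_indic n (M : R) (t : n.-tuple C) : R :=
  \prod_(i < n) (itv_indic (- M) M (complex.Re (tnth t i)) * itv_indic (- M) M (complex.Im (tnth t i))).

Lemma cube_indic_ge0 n M (t : n.-tuple C) : 0 <= cube_indic M t.
Proof. by apply: prodr_ge0 => i _; rewrite mulr_ge0 ?itv_indic_ge0. Qed.

Lemma measurable_cube_indic n M : measurable_fun setT (@cube_indic n M).
Proof.
apply: measurable_prod => i _.
have mt : measurable_fun setT (fun t : n.-tuple C => tnth t i) by exact: measurable_tnth.
by apply: measurable_funM; apply: (measurableT_comp (measurable_itv_indic _ _));
  [exact: (measurableT_comp (@measurable_Re R))|exact: (measurableT_comp (@measurable_Im R))].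
Qed.

Lemma cube_indic_cons n M (x : C * n.-tuple C) :
  cube_indic M (tuple_cons x) = itv_indic (- M) M (complex.Re x.1) * itv_indic (- M) M (complex.Im x.1) * cube_indic M x.2.
Proof.
rewrite /cube_indic big_ord_recl; congr (_ * _).
by apply: eq_bigr => j _; rewrite tnthS.
Qed.

Lemma integral_cube_indic n M : 0 <= M ->
  (\int[lambda n]_t (cube_indic M t)%:E = (((2 * M) ^+ 2) ^+ n)%:E)%E.
Proof.
move=> M0.
have mE k : measurable_fun setT (fun t : k.-tuple C => (cube_indic M t)%:E).
  by apply/measurable_EFinP; exact: measurable_cube_indic.
elim: n => [|n IH].
  by rewrite integral_tuple0// /cube_indic big_ord0 expr0.
rewrite integral_tuple_cons//; last by move=> z; rewrite lee_fin cube_indic_ge0.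
have mRI : measurable_fun setT (fun x : C => itv_indic (- M) M (complex.Re x) * itv_indic (- M) M (complex.Im x)).
  by apply: measurable_funM; apply: (measurableT_comp (measurable_itv_indic _ _));
    [exact: measurable_Re|exact: measurable_Im].
have E (x : C) : (\int[lambda n]_t (cube_indic M (tuple_cons (x, t)))%:E =
    (((2 * M) ^+ 2) ^+ n)%:E * (itv_indic (- M) M (complex.Re x) * itv_indic (- M) M (complex.Im x))%:E)%E.
  rewrite -IH muleC -ge0_integralZl_EFin; last 4 first.
  - by [].
  - by move=> t _; rewrite lee_fin cube_indic_ge0.
  - exact: mE.
  - by rewrite mulr_ge0 ?itv_indic_ge0.
  by apply: eq_integral => t _; rewrite cube_indic_cons -EFinM.
under eq_integral do rewrite E.
rewrite ge0_integralZl_EFin//; last 3 first.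
- by move=> x _; rewrite lee_fin mulr_ge0 ?itv_indic_ge0.
- exact/measurable_EFinP.
- by rewrite exprn_ge0// sqr_ge0.
have MM : - M <= M by rewrite ge0_cp.
rewrite integral_lebesgueC/=; last 2 first.
- exact/measurable_EFinP.
- by move=> x; rewrite lee_fin mulr_ge0 ?itv_indic_ge0.
have E2 y : (\int[mu]_x (itv_indic (- M) M x * itv_indic (- M) M y)%:E = (2 * M)%:E * (itv_indic (- M) M y)%:E)%E.
  under eq_integral do rewrite mulrC EFinM.
  rewrite ge0_integralZl_EFin ?itv_indic_ge0//; last 2 first.
  - by move=> x _; rewrite lee_fin itv_indic_ge0.
  - by apply/measurable_EFinP; exact: measurable_itv_indic.
  by rewrite integral_itv_indic// opprK -mulr2n mulr_natl muleC.
under eq_integral do rewrite E2.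
rewrite ge0_integralZl_EFin//; last 3 first.
- by move=> x _; rewrite lee_fin itv_indic_ge0.
- by apply/measurable_EFinP; exact: measurable_itv_indic.
- by rewrite mulr_ge0.
rewrite integral_itv_indic// opprK -!EFinM; congr EFin; rewrite (exprSr _ n).
by congr (_ * _); ring.
Qed.

Section BoxW.
Variable n : nat.
Local Notation W := (n.-tuple C * (rT * rT))%type.
Local Notation Cn1 := (n.-tuple C * C)%type.

Definition inbox (M T d e : R) (w : n.-tuple C * (R * R)) : bool :=
  [&& [forall i, (- M < complex.Re (tnth w.1 i) < M) && (- M < complex.Im (tnth w.1 i) < M)],
      d < w.2.1 < e & - T < w.2.2 < T].

Definition box_indic (M T d e : R) (w : n.-tuple C * (R * R)) : R :=
  cube_indic M w.1 * (itv_indic d e w.2.1 * itv_indic (- T) T w.2.2).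

Lemma box_indicE M T d e w : box_indic M T d e w = (inbox M T d e w)%:R.
Proof.
rewrite /box_indic /inbox !itv_indicE.
have -> : cube_indic M w.1 = [forall i, (- M < complex.Re (tnth w.1 i) < M) && (- M < complex.Im (tnth w.1 i) < M)]%R%:R.
  rewrite /cube_indic; case: forallP => [h|h].
    by apply: big1 => i _; rewrite !itv_indicE; have /andP[-> ->] := h i; rewrite mulr1.
  move/existsNP : h => [i /negP hi].
  apply/eqP/prodf_eq0; exists i => //; rewrite !itv_indicE -natrM mulnb.
  by rewrite (negbTE hi).
by rewrite -!natrM !mulnb.
Qed.

Lemma box_indic_ge0 M T d e w : 0 <= box_indic M T d e w.
Proof. by rewrite box_indicE. Qed.

Lemma measurable_box_indic M T d e : measurable_fun setT (box_indic M T d e : W -> R).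
Proof.
have m1 : measurable_fun setT (fun w : W => w.2.1 : R).
  exact: (measurableT_comp (@measurable_fst _ _ _ _)).
have m2 : measurable_fun setT (fun w : W => w.2.2 : R).
  exact: (measurableT_comp (@measurable_snd _ _ _ _)).
apply: measurable_funM.
  by apply: (measurableT_comp (@measurable_cube_indic n M)); exact: measurable_fst.
by apply: measurable_funM; exact: (measurableT_comp (measurable_itv_indic _ _)).
Qed.

(** Coordinates in which the domain is a half-space, foliated by the horospheres
    of constant height; they invert the transport of the base point. *)
Definition horo (z : Cn1) : W := (z.1, (height z, complex.Re z.2)).

Lemma measurable_horo : measurable_fun setT horo.
Proof.
apply: measurable_fun_pair; first exact: measurable_fst.
apply: measurable_fun_pair; first exact: measurable_height.
by apply: (measurableT_comp (@measurable_Re R)); exact: measurable_snd.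
Qed.

Definition base_point : Cn1 := ([tuple (0 : C) | i < n], Complex 0 1).

Lemma height_base_point : height base_point = 1.
Proof.
rewrite /height /normsq/= big1 ?subr0// => j _.
by rewrite tnth_mktuple normc_sqr/= !expr0n/= addr0.
Qed.

Lemma horo_transport_base (w : W) : horo (transport base_point w) = w.
Proof.
case: w => t [s u]; rewrite /horo height_transport /transport height_base_point/= sqrtr1.
have -> : hermIm base_point.1 t = 0.
  by rewrite /hermIm big1// => j _; rewrite tnth_mktuple mul0r.
rewrite mulr0 !addr0 !mul1r; congr pair.
apply: eq_from_tnth => j; rewrite !tnth_mktuple add0r.
by rewrite (_ : 1%:C%C = 1) ?mul1r.
Qed.

(** The measure of a box for dV / height, the Haar measure invariant under
    z |-> transport z w; the height ranges in a logarithmic scale. *)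
Definition mass (M T d e : R) : R := ((2 * M) ^+ 2) ^+ n * ((ln e - ln d) * (2 * T)).

Lemma integral_box_indic_horo M T d e : 0 <= M -> 0 <= T -> 0 < d -> d < e ->
  (\int[dV R n]_z (box_indic M T d e (horo z) * posp (- 1) (height z))%:E = (mass M T d e)%:E)%E.
Proof.
move=> M0 T0 d0 de.
have h1 := height_base_point.
have hb : 0 < height base_point by rewrite h1.
have mB := measurable_box_indic M T d e.
have mF : measurable_fun setT (fun z : Cn1 => (box_indic M T d e (horo z) * posp (- 1) (height z))%:E).
  apply/measurable_EFinP; apply: measurable_funM.
    exact: (measurableT_comp mB measurable_horo).
  exact: (measurableT_comp (@measurable_posp _ _) (@measurable_height R n)).
rewrite (integral_transport hb mF); last by move=> w; rewrite lee_fin mulr_ge0 ?posp_ge0 ?box_indic_ge0.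
rewrite h1 expr1n mul1e.
have m1 : measurable_fun setT (fun w : W => w.2.1 : R).
  exact: (measurableT_comp (@measurable_fst _ _ _ _)).
pose G (w : W) := (cube_indic M w.1 * ((itv_indic d e w.2.1 * posp (- 1) w.2.1) * itv_indic (- T) T w.2.2))%:E.
transitivity (\int[@dW R n]_w G w)%E.
  apply: eq_integral => w _; rewrite horo_transport_base height_transport h1 mul1r.
  by congr EFin; rewrite /box_indic -!mulrA; congr (_ * (_ * _)); rewrite mulrC.
have G0 w : (0 <= G w)%E by rewrite lee_fin !mulr_ge0 ?cube_indic_ge0 ?itv_indic_ge0 ?posp_ge0.
have mG2 : measurable_fun setT (fun w : rT * rT => ((itv_indic d e w.1 * posp (- 1) w.1) * itv_indic (- T) T w.2)).
  apply: measurable_funM.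
    have m : measurable_fun setT (fun s : R => itv_indic d e s * posp (- 1) s).
      by apply: measurable_funM; [exact: measurable_itv_indic|exact: measurable_posp].
    by apply: (measurableT_comp m); exact: measurable_fst.
  by apply: (measurableT_comp (measurable_itv_indic _ _)); exact: measurable_snd.
have mG : measurable_fun setT G.
  apply/measurable_EFinP; apply: measurable_funM.
    by apply: (measurableT_comp (@measurable_cube_indic n M)); exact: measurable_fst.
  by apply: (measurableT_comp mG2); exact: measurable_snd.
have ive s : 0 <= itv_indic d e s * posp (- 1) s by rewrite mulr_ge0 ?itv_indic_ge0 ?posp_ge0.
have L0 : 0 <= ln e - ln d by rewrite subr_ge0 ler_ln ?posrE// ?(ltW de)// (lt_trans d0).
have TT : - T <= T by rewrite ge0_cp.
rewrite /dW integral_sfproduct//.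
have E1 s : (\int[mu]_u ((itv_indic d e s * posp (- 1) s) * itv_indic (- T) T u)%:E = (2 * T)%:E * (itv_indic d e s * posp (- 1) s)%:E)%E.
  under eq_integral do rewrite EFinM.
  rewrite ge0_integralZl_EFin//; last 2 first.
  - by move=> x _; rewrite lee_fin itv_indic_ge0.
  - by apply/measurable_EFinP; exact: measurable_itv_indic.
  by rewrite integral_itv_indic// opprK -mulr2n mulr_natl muleC.
have E2 : (\int[sfproduct mu mu]_w ((itv_indic d e w.1 * posp (- 1) w.1) * itv_indic (- T) T w.2)%:E = ((ln e - ln d) * (2 * T))%:E)%E.
  rewrite (@integral_sfproduct _ _ rT rT R mu mu (fun w => ((itv_indic d e w.1 * posp (- 1) w.1) * itv_indic (- T) T w.2)%:E)); last 2 first.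
  - exact/measurable_EFinP.
  - by move=> w; rewrite lee_fin mulr_ge0 ?itv_indic_ge0.
  under eq_integral do rewrite /= E1.
  rewrite ge0_integralZl_EFin//; last 3 first.
  - by move=> x _; rewrite lee_fin.
  - by apply/measurable_EFinP; apply: measurable_funM; [exact: measurable_itv_indic|exact: measurable_posp].
  - by rewrite mulr_ge0.
  by rewrite integral_itv_indic_inv// -EFinM mulrC.
transitivity (\int[lambda n]_t (((ln e - ln d) * (2 * T))%:E * (cube_indic M t)%:E))%E.
  apply: eq_integral => t _; rewrite -E2 muleC -ge0_integralZl_EFin; last 4 first.
  - by [].
  - by move=> w _; rewrite lee_fin mulr_ge0 ?itv_indic_ge0.
  - exact/measurable_EFinP.
  - exact: cube_indic_ge0.
  by apply: eq_integral => w _; rewrite -EFinM.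
rewrite ge0_integralZl_EFin//; last 3 first.
- by move=> x _; rewrite lee_fin cube_indic_ge0.
- by apply/measurable_EFinP; exact: measurable_cube_indic.
- by rewrite mulr_ge0// mulr_ge0.
by rewrite integral_cube_indic// -EFinM mulrC.
Qed.

Lemma ltr_norml_itv (a M : R) : (- M < a < M) = (`|a| < M).
Proof. by rewrite ltr_norml. Qed.

(** As the height of z is at most 1, transport moves the real and imaginary parts
    of z' by at most k; it multiplies the height by a factor between 1/k and k,
    and moves Re z_{n+1} by at most k plus the twist.  Each of the n terms of the Hermitian product is at most
    2 M k, and the twist doubles their sum, whence 4 n M k. *)
Lemma inbox_transport (k M T d : R) (z : Cn1) (w : W) : 1 < k -> 0 < d ->
  inbox (M - k) (T - (k + 4 * n%:R * M * k)) (k * d) (k^-1) (horo z) ->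
  inbox k k k^-1 k w -> inbox M T d 1 (horo (transport z w)).
Proof.
move=> k1 d0 /and3P[/forallP Hz /andP[hz1 hz2] tz] /and3P[/forallP Hw /andP[s1 s2] tw].
have k0 : 0 < k by exact: lt_trans k1.
rewrite /= in hz1 hz2 tz.
have r0 : 0 < height z by apply: lt_trans hz1; rewrite mulr_gt0.
have r1 : height z < 1 by apply: lt_trans hz2 _; rewrite invf_lt1.
set a := Num.sqrt (height z).
have a0 : 0 <= a by exact: sqrtr_ge0.
have a1 : a <= 1 by rewrite -sqrtr1 ler_wsqrtr// ltW.
have Mk0 i : `|complex.Re (tnth z.1 i)| < M - k /\ `|complex.Im (tnth z.1 i)| < M - k.
  by have /andP[] := Hz i; rewrite !ltr_norml_itv.
have k0' i : `|complex.Re (tnth w.1 i)| < k /\ `|complex.Im (tnth w.1 i)| < k.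
  by have /andP[] := Hw i; rewrite !ltr_norml_itv.
have ax (x : R) : `|x| < k -> `|a * x| < k.
  move=> xk; rewrite normrM (ger0_norm a0); apply: le_lt_trans xk.
  by rewrite -[leRHS]mul1r ler_wpM2r.
apply/and3P; split.
- apply/forallP => i; rewrite !ltr_norml_itv /= tnth_mktuple.
  have [zr zi] := Mk0 i; have [wr wi] := k0' i.
  have -> : complex.Re (tnth z.1 i + a%:C%C * tnth w.1 i) = complex.Re (tnth z.1 i) + a * complex.Re (tnth w.1 i).
    by case: (tnth z.1 i) (tnth w.1 i) => [p q] [p' q'] /=; rewrite mul0r subr0.
  have -> : complex.Im (tnth z.1 i + a%:C%C * tnth w.1 i) = complex.Im (tnth z.1 i) + a * complex.Im (tnth w.1 i).
    by case: (tnth z.1 i) (tnth w.1 i) => [p q] [p' q'] /=; rewrite mul0r addr0.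
  by apply/andP; split; apply: (le_lt_trans (ler_normD _ _));
    rewrite -(subrK k M) ltrD// ax.
- rewrite /= height_transport; apply/andP; split.
    have : k * d * k^-1 < height z * w.2.1.
      by apply: ltr_pM => //; rewrite ?mulr_ge0 ?invr_ge0 ?(ltW d0)// ltW.
    by rewrite mulrAC mulfV ?mul1r// gt_eqF.
  have : height z * w.2.1 < k^-1 * k.
    by apply: ltr_pM => //; rewrite ltW// (lt_trans _ s1)// invr_gt0.
  by rewrite mulVf// gt_eqF.
- rewrite ltr_norml_itv /= -/a.
  rewrite ltr_norml_itv in tz; rewrite ltr_norml_itv in tw.
  have hb : `|hermIm z.1 w.1| <= n%:R * (2 * M * k).
    apply: (le_trans (ler_norm_sum _ _ _)).
    rewrite (_ : n%:R * (2 * M * k) = \sum_(i < n) (2 * M * k)); last first.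
      by rewrite sumr_const card_ord mulr_natl.
    apply: ler_sum => i _.
    have [zr zi] := Mk0 i; have [wr wi] := k0' i.
    have -> : complex.Im (tnth z.1 i * conjc (tnth w.1 i)) =
       complex.Im (tnth z.1 i) * complex.Re (tnth w.1 i) - complex.Re (tnth z.1 i) * complex.Im (tnth w.1 i).
      by case: (tnth z.1 i) (tnth w.1 i) => [p q] [p' q'] /=; ring.
    apply: (le_trans (ler_normB _ _)); rewrite !normrM.
    have MM : M - k <= M by rewrite gerBl ltW.
    rewrite (_ : 2 * M * k = M * k + M * k); last by ring.
    by apply: lerD; apply: ler_pM => //; rewrite ltW// (lt_le_trans _ MM).
  have h1 : `|height z * w.2.2| <= k.
    rewrite normrM (gtr0_norm r0) -[leRHS]mul1r; apply: ler_pM => //; exact: ltW.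
  have h2 : `|2 * a * hermIm z.1 w.1| <= 4 * n%:R * M * k.
    rewrite normrM (ger0_norm (_ : 0 <= 2 * a)); last by rewrite mulr_ge0.
    apply: (@le_trans _ _ (2 * (n%:R * (2 * M * k)))); last by rewrite le_eqVlt; apply/orP; left; apply/eqP; ring.
    by apply: ler_pM => //; rewrite ?mulr_ge0// -[leRHS]mulr1 ler_wpM2l.
  apply: (le_lt_trans (ler_normD _ _)).
  apply: (@lt_le_trans _ _ (k + ((T - (k + 4 * n%:R * M * k)) + 4 * n%:R * M * k))); last first.
    by rewrite le_eqVlt; apply/orP; left; apply/eqP; ring.
  apply: ler_ltD => //.
  by apply: (le_lt_trans (ler_normD _ _)); apply: ltr_leD.
Qed.

End BoxW.

End Boxes.

(** * The lower bound *)

Section Lower.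
Context (R : realType) (n : nat) (alpha p : R).
Hypotheses (alpha1 : -1 < alpha) (p1 : 1 <= p) (pa : 1 < p * (1 + alpha)).
Local Notation C := R[i].
Local Notation Cn1 := (n.-tuple C * C)%type.
Local Notation rT := (measurableTypeR R).
Local Notation W := (n.-tuple C * (rT * rT))%type.
Local Notation U := (@siegel R n).
Local Notation V := (dV R n).
Local Notation A := (kernel_const n alpha p^-1).
Local Notation c0 := (T_const R n).

Let p0 : 0 < p. Proof. exact: lt_le_trans ltr01 p1. Qed.
Let a1 : 0 < 1 + alpha. Proof. by rewrite -ltrBlDl sub0r. Qed.
Let b0 : 0 < p^-1. Proof. by rewrite invr_gt0. Qed.
Let ba : p^-1 < 1 + alpha.
Proof. by rewrite -[ltLHS]mul1r ltr_pdivrMr// mulrC. Qed.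

Definition boxset (k : R) : set W := [set w | inbox k k k^-1 k w].

Lemma measurable_boxset k : measurable (boxset k).
Proof.
have -> : boxset k = (box_indic k k k^-1 k : W -> R) @^-1` [set 1].
  apply/seteqP; split => w; rewrite /boxset /= box_indicE; first by move=> ->.
  by case: inbox => // /esym/eqP; rewrite oner_eq0.
by rewrite -[X in measurable X]setTI; apply: measurable_box_indic.
Qed.

Local Notation I0 := (fun w : W => (kernel0 alpha w * posp (- p^-1) w.2.1)%:E).

Let mI0 : measurable_fun setT I0.
Proof.
have m1 : measurable_fun setT (fun w : W => w.2.1 : R).
  exact: (measurableT_comp (@measurable_fst _ _ _ _)).
by apply/measurable_EFinP; have := @measurable_kernel0 R n alpha => mk; meas.
Qed.

Let I0_ge0 w : (0 <= I0 w)%E.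
Proof. by rewrite lee_fin mulr_ge0 ?posp_ge0 ?kernel0_ge0. Qed.

(** The part of [kernel_const] carried by a box around the base point. *)
Definition box_const (k : R) : \bar R := (\int[@dW R n]_(w in boxset k) I0 w)%E.

Lemma box_const_ge0 k : (0 <= box_const k)%E.
Proof. exact: integral_ge0. Qed.

Lemma box_const_le k : (box_const k <= A%:E)%E.
Proof.
rewrite -integral_kernel0//; apply: ge0_subset_integral => //.
exact: measurable_boxset.
Qed.

Lemma box_const_fin k : box_const k \is a fin_num.
Proof.
rewrite ge0_fin_numE ?box_const_ge0//.
exact: le_lt_trans (box_const_le k) (ltry _).
Qed.

Lemma inbox_le (k l : R) (w : W) : 1 < k -> k <= l -> inbox k k k^-1 k w -> inbox l l l^-1 l w.
Proof.
move=> k1 kl /and3P[/forallP hw /andP[s1 s2]].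
have k0 : 0 < k by exact: lt_trans k1.
have l0 : 0 < l by exact: lt_le_trans kl.
rewrite ltr_norml_itv => t1; apply/and3P; split.
- apply/forallP => i; have := hw i; rewrite !ltr_norml_itv => /andP[x1 x2].
  by rewrite (lt_le_trans x1)// (lt_le_trans x2).
- by rewrite (lt_le_trans s2)// andbT (le_lt_trans _ s1)// lef_pV2.
- by rewrite ltr_norml_itv (lt_le_trans t1).
Qed.

Lemma cvg_box_const : box_const i.+2%:R @[i --> \oo] --> A%:E.
Proof.
have -> : A%:E = (\int[@dW R n]_(w in \bigcup_i boxset i.+2%:R) I0 w)%E.
  rewrite -integral_kernel0// [RHS]integral_mkcond; apply: eq_integral => w _.
  rewrite patchE; case: ifPn => // /negP wU.
  have [s0|s0] := ltP 0 (w.2.1 : R); last by rewrite /kernel0 posp_le0E// !mul0r.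
  exfalso; apply: wU; apply/mem_set.
  (* K dominates the coordinates of w and the inverse of its height, so that w
     lies in the box of size truncn K + 2. *)
  pose S : R := \sum_(i < n) normc (tnth w.1 i).
  have S0 : 0 <= S by apply: sumr_ge0 => i _; exact: normc_ge0.
  pose K := S + `|w.2.2 : R| + w.2.1 + w.2.1^-1.
  have KS : K < (Num.truncn K).+2%:R.
    by apply: lt_trans (truncnS_gt K) _; rewrite ltr_nat.
  set l := (Num.truncn K).+2%:R in KS *.
  have i0 : 0 < w.2.1^-1 by rewrite invr_gt0.
  have t0 : 0 <= `|w.2.2 : R| by [].
  exists (Num.truncn K) => //; rewrite /boxset /= -/l.
  have hK (x : R) : x <= K -> x < l by move=> h; exact: le_lt_trans KS.
  have K1 : S <= K by rewrite /K -!addrA lerDl !addr_ge0// ltW.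
  apply/and3P; split.
  - apply/forallP => i; rewrite !ltr_norml_itv.
    have nS : normc (tnth w.1 i) <= S.
      by rewrite /S (bigD1 i)//= lerDl sumr_ge0// => j _; exact: normc_ge0.
    by apply/andP; split; apply: hK; apply: le_trans K1; apply: le_trans nS;
      [exact: normRe|exact: normIm].
  - apply/andP; split.
      have sl : w.2.1^-1 < l by apply: hK; rewrite /K lerDr !addr_ge0// ltW.
      by rewrite -[ltRHS]invrK ltf_pV2 ?posrE// (lt_trans i0 sl).
    by apply: hK; rewrite /K -addrA addrC -addrA lerDl !addr_ge0// ltW.
  - rewrite ltr_norml_itv; apply: hK; rewrite /K -!addrA addrCA lerDl !addr_ge0// ltW//.
apply: ge0_nondecreasing_set_cvg_integral => //.
- apply/nondecreasing_seqP => i; rewrite subsetEset => w; rewrite /boxset /=.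
  by apply: inbox_le; [rewrite ltr1n|rewrite ler_nat].
- by move=> i; exact: measurable_boxset.
- by move=> i; exact: measurable_funTS.
Qed.

Section TestFunction.
Variables (k : R) (j : nat).
Hypotheses (k1 : 1 < k) (j2 : (1 < j)%N).
Let k0 : 0 < k. Proof. exact: lt_trans k1. Qed.
(** The large box has each of its dimensions, logarithmically for the height,
    equal to j times what a transport by a point of the box of size k can move;
    the small box loses one such unit in each dimension.  Hence every dimension
    shrinks by the factor x = 1 - 1/j, and there are 2n + 2 of them. *)
Let M : R := j%:R * k.
Let L : R := k + 4 * n%:R * M * k.
Let T : R := j%:R * L.
Let d : R := k ^- (2 * j).
Let x : R := 1 - j%:R^-1.

Let j0 : 0 < j%:R :> R. Proof. by rewrite ltr0n ltnW. Qed.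
Let M0 : 0 < M. Proof. exact: mulr_gt0. Qed.
Let L0 : 0 < L. Proof. by rewrite ltr_pwDl// !mulr_ge0// ltW. Qed.
Let T0 : 0 < T. Proof. exact: mulr_gt0. Qed.
Let d0 : 0 < d. Proof. by rewrite invr_gt0 exprn_gt0. Qed.
Let d1 : d < 1.
Proof. by rewrite invf_lt1 ?exprn_gt0// exprn_egt1// muln_eq0/= -lt0n ltnW. Qed.
Let x0 : 0 < x. Proof. by rewrite subr_gt0 invf_lt1// ltr1n. Qed.
Let x1 : x <= 1. Proof. by rewrite gerBl invr_ge0 ltW. Qed.
Let lnd : ln d = - (2 * j)%:R * ln k.
Proof. by rewrite lnV ?posrE ?exprn_gt0// lnXn// mulNr mulr_natl. Qed.
Let m0 := mass n M T d 1.
Let m0_gt0 : 0 < m0.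
Proof.
rewrite /m0 /mass mulr_gt0//; first by rewrite !exprn_gt0// mulr_gt0.
rewrite mulr_gt0 ?mulr_gt0// subr_gt0 ltr_ln ?posrE//.
Qed.

Let Mk : M - k = x * M.
Proof. by rewrite /M /x; field; rewrite gt_eqF. Qed.
Let TL : T - L = x * T.
Proof. by rewrite /T /x; field; rewrite gt_eqF. Qed.
Let kd : k * d < k^-1.
Proof.
rewrite -ltf_pV2 ?posrE ?invr_gt0 ?mulr_gt0// invrK invfM invrK.
rewrite -ltr_pdivrMl ?invr_gt0// invrK -expr2.
by rewrite ltr_eXn2l// -[X in (X < _)%N]muln1 ltn_mul2l.
Qed.

Lemma mass_shrink : mass n (M - k) (T - L) (k * d) k^-1 = x ^+ (2 * n.+1) * m0.
Proof.
have ll : ln k^-1 - ln (k * d) = x * (ln 1 - ln d).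
  rewrite lnV ?posrE// lnM ?posrE// lnd ln1 /x natrM.
  by field; rewrite gt_eqF.
rewrite /m0 /mass ll Mk TL.
have -> : (2 * (x * M)) ^+ 2 ^+ n = x ^+ (2 * n) * (2 * M) ^+ 2 ^+ n.
  by rewrite exprM -exprMn -exprMn mulrCA.
rewrite mulnS exprD.
by move: ((_ ^+ 2) ^+ n) (x ^+ (2 * n)) (ln 1 - _) => y1 y2 y3; ring.
Qed.

(** The normalisation that gives the test function norm 1. *)
Let c := m0 `^ (- p^-1).
Let c_gt0 : 0 < c. Proof. exact: powR_gt0. Qed.
Let cp : c `^ p = m0^-1.
Proof. by rewrite /c -powRrM mulNr mulVf ?gt_eqF// powR_inv1// ltW. Qed.

Definition test_real (z : Cn1) : R := c * (posp (- p^-1) (height z) * box_indic M T d 1 (horo z)).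
Definition test_fun (z : Cn1) : C := Complex (test_real z) 0.

Let F_ge0 z : 0 <= test_real z.
Proof. by rewrite mulr_ge0 ?(ltW c_gt0)// mulr_ge0 ?posp_ge0 ?box_indic_ge0. Qed.

Let mF : measurable_fun setT test_real.
Proof.
apply: measurable_funM => //; apply: measurable_funM.
  exact: (measurableT_comp (@measurable_posp _ _) (@measurable_height R n)).
exact: (measurableT_comp (measurable_box_indic _ _ _ _) (@measurable_horo R n)).
Qed.

Let mf : measurable_fun U test_fun.
Proof. by apply: measurable_funTS; apply: measurable_Complex. Qed.

Let posp_p (h : R) : posp (- p^-1) h `^ p = posp (- 1) h.
Proof.
have [h0|h0] := ltP 0 h; last by rewrite !posp_le0E// powR0// gt_eqF.
by rewrite !posp_gt0E// -powRrM mulNr mulVf// gt_eqF.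
Qed.

Let normLp_test_fun : normLp V U p test_fun = 1%E.
Proof.
have E : (normLp V U p test_fun `^ p = 1)%E.
  rewrite (poweR_normLp _ _ p1).
  transitivity (\int[V]_z ((m0^-1)%:E * (box_indic M T d 1 (horo z) * posp (- 1) (height z))%:E))%E.
    apply: eq_integral => z _; rewrite -EFinM; congr EFin.
    rewrite patchE; case: ifPn => [_|/negP Uz]; last first.
      rewrite powR0 ?gt_eqF// (@posp_le0E _ _ (height z)) ?mulr0// leNgt; apply/negP => h.
      by apply: Uz; apply/mem_set/siegelE.
    have -> : normc (test_fun z) = test_real z.
      by rewrite /= expr0n/= addr0 sqrtr_sqr ger0_norm.
    rewrite /test_real box_indicE !powRM ?mulr_ge0 ?posp_ge0 ?(ltW c_gt0)//.
    rewrite cp posp_p [X in _ = _ * X]mulrC; congr (_ * (_ * _)).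
    by case: inbox; rewrite ?powR1// powR0// gt_eqF.
  rewrite ge0_integralZl_EFin; last 4 first.
  - by [].
  - by move=> z _; rewrite lee_fin mulr_ge0 ?posp_ge0 ?box_indic_ge0.
  - apply/measurable_EFinP; apply: measurable_funM.
      exact: (measurableT_comp (measurable_box_indic _ _ _ _) (@measurable_horo R n)).
    exact: (measurableT_comp (@measurable_posp _ _) (@measurable_height R n)).
  - by rewrite invr_ge0 ltW.
  by rewrite integral_box_indic_horo ?(ltW M0) ?(ltW T0)// -EFinM mulVf// gt_eqF.
apply/eqP; rewrite eq_le; apply/andP; split; apply: (ler_poweR p1);
  by rewrite ?normLp_ge0 ?lee_fin// E poweR1r.
Qed.

Lemma Re_realM (a : R) (z : C) : complex.Re (a%:C%C * z) = a * complex.Re z.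
Proof. by case: z => y1 y2 /=; rewrite mul0r subr0. Qed.

(** All points transport z w with w in the small box around the base point lie
    in the support of the test function, and the integrand is nonnegative. *)
Let T_op_test_fun z : inbox (M - k) (T - L) (k * d) k^-1 (horo z) ->
  c0 * c * fine (box_const k) * posp (- p^-1) (height z) <= normc (T_op alpha test_fun z).
Proof.
move=> Bz; have hz : 0 < height z.
  by case/and3P: Bz => _ /andP[h _] _; apply: lt_trans h; exact: mulr_gt0.
apply: le_trans (normRe _); apply: le_trans (ler_norm _).
have -> : complex.Re (T_op alpha test_fun z) =
    c0 * fine (\int[V]_(w in U) (T_kernel alpha z w * test_real w)%:E)%E.
  rewrite /T_op Re_realM; congr (_ * _).
  by apply: (congr1 fine); apply: eq_integral => w _; rewrite Re_realM.
have -> : c0 * c * fine (box_const k) * posp (- p^-1) (height z) =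
    c0 * (c * (fine (box_const k) * posp (- p^-1) (height z))) by ring.
rewrite ler_pM2l ?T_const_gt0//.
have mT : measurable_fun setT (fun w => T_kernel alpha z w).
  exact: (measurableT_comp (@measurable_T_kernel R n alpha) (@pair1_measurable _ _ _ _ z)).
have fin : (\int[V]_(w in U) (T_kernel alpha z w * test_real w)%:E)%E \is a fin_num.
  rewrite ge0_fin_numE; last first.
    by apply: integral_ge0 => w _; rewrite lee_fin mulr_ge0// T_kernel_ge0.
  apply: (@le_lt_trans _ _ (\int[V]_(w in U) (c%:E * (T_kernel alpha z w * posp (- p^-1) (height w))%:E))%E).
    apply: ge0_le_integral => //.
    - exact: measurable_siegel.
    - by move=> w _; rewrite lee_fin mulr_ge0// T_kernel_ge0.
    - by apply: measurable_funTS; apply/measurable_EFinP; apply: measurable_funM.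
    - apply: measurable_funTS; apply: measurable_funeM; apply/measurable_EFinP; apply: measurable_funM => //.
      exact: (measurableT_comp (@measurable_posp _ _) (@measurable_height R n)).
    - move=> w _; rewrite -EFinM lee_fin /test_real mulrCA ler_pM2l//.
      apply: ler_wpM2l; first exact: T_kernel_ge0.
      rewrite -[leRHS]mulr1; apply: ler_wpM2l; first exact: posp_ge0.
      by rewrite box_indicE; case: inbox.
  rewrite ge0_integralZl_EFin; last 4 first.
  - exact: measurable_siegel.
  - by move=> w _; rewrite lee_fin mulr_ge0 ?posp_ge0// T_kernel_ge0.
  - apply: measurable_funTS; apply/measurable_EFinP; apply: measurable_funM => //.
    exact: (measurableT_comp (@measurable_posp _ _) (@measurable_height R n)).
  - exact: ltW.
  by rewrite integral_T_kernel_height// -EFinM ltry.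
rewrite -lee_fin fineK// integral_T_kernel//.
rewrite mulrCA mulrC EFinM fineK ?box_const_fin// /box_const.
have mI : measurable_fun (boxset k) I0 by exact: measurable_funTS.
rewrite -ge0_integralZl_EFin//; last 2 first.
- exact: measurable_boxset.
- by rewrite mulr_ge0 ?posp_ge0// ltW.
rewrite integral_mkcond; apply: ge0_le_integral => //.
- by move=> w _; apply: erestrict_ge0 => v _; rewrite mule_ge0// lee_fin mulr_ge0 ?posp_ge0// ltW.
- apply: (measurable_restrictT _ _).1; first exact: measurable_boxset.
  exact: measurable_funeM.
- apply/measurable_EFinP; apply: measurable_funM; first exact: measurable_kernel0.
  exact: (measurableT_comp mF (@measurable_transport R n z)).
move=> w _; rewrite patchE; case: ifPn => [/set_mem Bw|_]; last first.
  by rewrite lee_fin mulr_ge0// kernel0_ge0.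
rewrite -EFinM lee_fin /test_real height_transport pospM// (posp_gt0E _ hz).
rewrite box_indicE (inbox_transport k1 d0 Bz Bw) mulr1.
by rewrite le_eqVlt; apply/orP; left; apply/eqP; move: (_ `^ _) (posp _ _) (kernel0 _ _) => *; ring.
Qed.

(** The quotient of the p-norms is at least box_const times the p-th root of the
    quotient of the measures; as this quotient is at most 1 and p >= 1, its
    p-th root is at least the quotient itself. *)
Lemma opnorm_ge_test : ((c0 * fine (box_const k) * x ^+ (2 * n.+1))%:E <=
  opnormLp V U p (@T_op R n alpha))%E.
Proof.
apply: le_ereal_sup_tmp; exists (normLp V U p (T_op alpha test_fun)).
  exists test_fun => //; split; last by rewrite normLp_test_fun.
  by split; [exact: mf|rewrite normLp_test_fun ltry].
have b_ge0 : 0 <= fine (box_const k) by rewrite fine_ge0// box_const_ge0.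
have cb0 : 0 <= c0 * fine (box_const k) by rewrite mulr_ge0// ltW// T_const_gt0.
have xx0 : 0 <= x ^+ (2 * n.+1) by rewrite exprn_ge0// ltW.
apply: (ler_poweR p1); [by rewrite lee_fin mulr_ge0|exact: normLp_ge0|].
rewrite poweR_EFin (poweR_normLp _ _ p1).
apply: (@le_trans _ _ (((c0 * fine (box_const k) * c) `^ p)%:E *
   \int[V]_z (box_indic (M - k) (T - L) (k * d) k^-1 (horo z) * posp (- 1) (height z))%:E)%E).
  rewrite integral_box_indic_horo//; last 3 first.
  - by rewrite Mk mulr_ge0// ltW.
  - by rewrite TL mulr_ge0// ltW.
  - exact: mulr_gt0.
  rewrite mass_shrink -EFinM lee_fin (powRM p cb0 xx0) (powRM p cb0 (ltW c_gt0)) cp.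
  rewrite -[leRHS]mulrA; apply: ler_wpM2l; first exact: powR_ge0.
  rewrite mulrCA mulVf ?gt_eqF// mulr1.
  apply: ge1r_powR => //; rewrite exprn_gt0//=.
  by apply: exprn_ile1 => //; exact: ltW.
rewrite -ge0_integralZl_EFin; last 4 first.
- by [].
- by move=> z _; rewrite lee_fin mulr_ge0 ?posp_ge0 ?box_indic_ge0.
- apply/measurable_EFinP; apply: measurable_funM.
    exact: (measurableT_comp (measurable_box_indic _ _ _ _) (@measurable_horo R n)).
  exact: (measurableT_comp (@measurable_posp _ _) (@measurable_height R n)).
- exact: powR_ge0.
apply: ge0_le_integral => //.
- by move=> z _; rewrite mule_ge0// lee_fin ?powR_ge0// mulr_ge0 ?posp_ge0 ?box_indic_ge0.
- apply: measurable_funeM; apply/measurable_EFinP; apply: measurable_funM.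
    exact: (measurableT_comp (measurable_box_indic _ _ _ _) (@measurable_horo R n)).
  exact: (measurableT_comp (@measurable_posp _ _) (@measurable_height R n)).
- apply/measurable_EFinP.
  have mT := measurable_T_op alpha mf.
  have := measurable_patch_normc (@measurable_siegel R n) mT => mp.
  exact: (measurableT_comp (@measurable_powR R p) mp).
move=> z _; rewrite -EFinM lee_fin box_indicE.
case Bz: (inbox (M - k) (T - L) (k * d) k^-1 (horo z)); last first.
  by rewrite mul0r mulr0 powR_ge0.
have hz : 0 < height z.
  by case/and3P: Bz => _ /andP[h _] _; apply: lt_trans h; exact: mulr_gt0.
rewrite mul1r -posp_p -powRM ?posp_ge0//; last by rewrite mulr_ge0// ltW.
rewrite patchE mem_set; last exact/siegelE.
apply: ge0_ler_powR; rewrite ?(ltW p0) ?nnegrE//.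
- by rewrite mulr_ge0 ?posp_ge0// mulr_ge0// ltW.
- exact: normc_ge0.
- by have := T_op_test_fun Bz; rewrite (mulrAC c0).
Qed.

End TestFunction.

(** First let j tend to infinity with the box fixed, then let the box grow. *)
Lemma opnorm_ge : ((c0 * A)%:E <= opnormLp V U p (@T_op R n alpha))%E.
Proof.
set O := opnormLp _ _ _ _.
have step1 (k : R) : 1 < k -> (c0%:E * box_const k <= O)%E.
  move=> k1; rewrite -[box_const k]fineK ?box_const_fin// -EFinM.
  apply: (@cvge_le nat \oo _ R
    (fun j => (c0 * fine (box_const k) * (1 - j.+2%:R^-1) ^+ (2 * n.+1))%:E)).
    by apply: nearW => j; exact: opnorm_ge_test.
  apply: cvg_EFin; first exact: nearW.
  rewrite /comp/= -[X in _ --> X]mulr1; apply: cvgMl_tmp.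
  have cx : 1 - j.+2%:R^-1 @[j --> \oo] --> (1 : R).
    rewrite -[X in _ --> X]subr0; apply: cvgB; first exact: cvg_cst.
    by have := @cvg_harmonic R; rewrite -cvg_shiftS.
  have := @cvg_comp _ _ _ (fun j : nat => 1 - j.+2%:R^-1 : R) (fun y : R => y ^+ (2 * n.+1)) _ _ _
    cx (@exprn_continuous R (2 * n.+1) 1).
  by rewrite expr1n.
apply: (@cvge_le nat \oo _ R (fun i => c0%:E * box_const i.+2%:R)%E).
  by apply: nearW => i; apply: step1; rewrite ltr1n.
have -> : (c0 * A)%:E = (c0%:E * A%:E)%E by rewrite EFinM.
exact: (cvgeZl (isT : c0%:E \is a fin_num) cvg_box_const).
Qed.

End Lower.

Theorem theorem2 (R : realType) (n : nat) (alpha p : R) :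
  -1 < alpha -> 1 <= p -> 1 < p * (1 + alpha) ->
  (* T_alpha is a well-defined operator on L^p(U^n) *)
  (forall f : n.-tuple R[i] * R[i] -> R[i],
     Lp (dV R n) (@siegel R n) p f ->
     {ae dV R n, forall z, siegel z ->
        integrableC (dV R n) (@siegel R n)
          (fun w => (T_kernel alpha z w)%:C%C * f w)} /\
     Lp (dV R n) (@siegel R n) p (T_op alpha f)) /\
  opnormLp (dV R n) (@siegel R n) p (@T_op R n alpha) =
    ((n.+1)`!%:R * Gamma (1 + alpha - p^-1) * Gamma p^-1
       / Gamma ((n%:R + 2 + alpha) / 2) ^+ 2)%:E.
Proof.
move=> alpha1 p1 pa.
have p0 : 0 < p by exact: lt_le_trans ltr01 p1.
have A0 : 0 <= T_const R n * kernel_const n alpha p^-1.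
  rewrite mulr_ge0 ?(ltW (T_const_gt0 _ _))// ltW// kernel_const_gt0 ?invr_gt0//.
  by rewrite -[ltLHS]mul1r ltr_pdivrMr// mulrC.
split.
  move=> f [mf foo]; split; first exact: (ae_integrable_T_op alpha1 p1 pa mf foo).
  split; first exact: measurable_T_op.
  apply: (le_lt_trans (normLp_T_op_le alpha1 p1 pa mf)).
  by rewrite lte_mul_pinfty.
apply/eqP; rewrite -(T_const_kernel_const n p alpha1) eq_le; apply/andP; split.
  apply: ge_ereal_sup => _ [f [[mf foo] f1] <-].
  apply: (le_trans (normLp_T_op_le alpha1 p1 pa mf)).
  by rewrite -[leRHS]mule1; apply: lee_wpmul2l.
exact: opnorm_ge.
Qed.
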